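(* Let $\mu$ be a finite positive Borel measure on $(-1,1)$ that is regular. Let $I$ be a closed subinterval of $(-1,1)$ such that $\mu$ is absolutely continuous in an open interval containing $I$. Assume that $w$ is positive and continuous in $I$ (that is, $w$, regarded as a function on $(-1,1)$, is continuous at every point of $I$). Let $r,s$ be non-negative integers and $$K_n^{(r,s)}(x,x)=\sum_{k=0}^{n-1}p_k^{(r)}(x)\,p_k^{(s)}(x).$$ Let $$\tau_{r,s}=\begin{cases}0, & r+s\text{ odd},\\[2pt] \dfrac{(-1)^{(r-s)/2}}{r+s+1}, & r+s\text{ even}.\end{cases}$$ Let $I'$ be a closed subinterval of the interior $I^0$ of $I$. Then, uniformly for $x\in I'$, $$\lim_{n\to\infty}\frac{1}{n^{r+s+1}}K_n^{(r,s)}(x,x)=\frac{1}{\pi w(x)(1-x^2)^{(r+s+1)/2}}\,\tau_{r,s}.$$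
   Context: For a finite positive Borel measure $\mu$ on $(-1,1)$ with infinite support, the orthonormal polynomials are $p_n(x)=\gamma_n x^n+\cdots$, $\gamma_n>0$, $n\ge 0$, with $\int_{-1}^1 p_np_m\,d\mu=\delta_{mn}$; $p_k^{(r)}$ denotes the $r$th derivative of $p_k$. The measure $\mu$ is called regular (on $[-1,1]$) if $\lim_{n\to\infty}\gamma_n^{1/n}=2$. The function $w=d\mu/dx$ denotes (a fixed version of) the density of the absolutely continuous part of $\mu$. *)

(* Defs.v *)
From mathcomp Require Import all_boot all_order all_algebra.
From mathcomp Require Import all_classical all_reals all_analysis.
Set Implicit Arguments.
Unset Strict Implicit.
Unset Printing Implicit Defensive.
Import Order.TTheory GRing.Theory Num.Theory.
Import numFieldNormedType.Exports.
Local Open Scope classical_set_scope.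
Local Open Scope ring_scope.

Definition msupport (R : realType)
    (mu : {finite_measure set (measurableTypeR R) -> \bar R}) : set R :=
  [set x | -1 < x < 1 /\
           forall U : set R, open U -> U x -> (0 < mu U)%E].

Definition orthonormal_polys (R : realType)
    (mu : {finite_measure set (measurableTypeR R) -> \bar R})
    (p : nat -> {poly R}) : Prop :=
  [/\ forall n, size (p n) = n.+1,
      forall n, 0 < lead_coef (p n)
    & forall m n,
        (\int[mu]_(x in `](-1)%R, 1%R[) ((p m).[x] * (p n).[x])%:E
           = ((m == n)%:R)%:E)%E].

(* For p the orthonormal polynomials of mu: regularity of mu on [-1, 1]. *)
Definition regular_polys (R : realType) (p : nat -> {poly R}) : Prop :=
  lead_coef (p n) `^ n%:R^-1 @[n --> \oo] --> (2 : R).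

(* w is a version of the density in the Lebesgue decomposition
   mu = w dx + nu on ]-1, 1[, with nu singular (carried by the null set N).
   Nonnegativity of w almost everywhere is a consequence, not a requirement. *)
Definition ac_density (R : realType)
    (mu : {finite_measure set (measurableTypeR R) -> \bar R})
    (w : R -> R) : Prop :=
  lebesgue_measure.-integrable `]-1, 1[ (EFin \o w) /\
  exists (nu : {finite_measure set (measurableTypeR R) -> \bar R})
         (N : set (measurableTypeR R)),
    [/\ measurable N, lebesgue_measure N = 0%E, nu (~` N) = 0%E
      & forall A : set (measurableTypeR R),
          measurable A -> A `<=` `]-1, 1[ ->
          (mu A = (\int[lebesgue_measure]_(x in A) (w x)%:E) + nu A)%E].

Definition ac_on_oitv (R : realType)
    (mu : {finite_measure set (measurableTypeR R) -> \bar R})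
    (u v : R) : Prop :=
  mrestr mu (measurable_itv `]u, v[) `<< lebesgue_measure.

Definition cd_kernel_diag (R : realType) (p : nat -> {poly R})
    (r s n : nat) (x : R) : R :=
  \sum_(k < n) ((p k)^`(r)).[x] * ((p k)^`(s)).[x].

(* The exponent (r - s) / 2 is a possibly negative integer. *)
Definition tau (R : realType) (r s : nat) : R :=
  if odd (r + s) then 0
  else (-1) ^ ((r%:Z - s%:Z) %/ 2)%Z / (r + s + 1)%:R.

(* Main.v *)
Require Import Defs.
From mathcomp Require Import all_boot all_order all_algebra.
From mathcomp Require Import all_classical all_reals all_analysis.
From HB Require Import structures.
From mathcomp Require Import measurable_realfun zify ring lra.
Import Order.TTheory GRing.Theory Num.Theory.
Import numFieldNormedType.Exports.
Local Open Scope classical_set_scope.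
Local Open Scope ring_scope.

(** The kernels are treated through extremal problems. For a linear functional [l] on
    polynomials, [sum_(k < n) l (p_k) ^ 2] is the supremum of [l P ^ 2 / int P ^ 2 dmu] over
    polynomials [P] of degree less than [n], and polarization recovers [K_n^(r,s) (x, x)] from
    [l P = P^(r) x / n ^ r +- P^(s) x / n ^ s]. This supremum is compared with the one for the
    arcsine measure, where Chebyshev polynomials make it explicit. Multiplying [P] by a
    polynomial of degree [O(n / h)] that is 1 to high order at [x] and exponentially small away
    from [x] leaves [l P] unchanged, so that only the ratio [q = pi w sqrt(1 - x ^ 2)] of the two
    measures near [x] matters. Far from [x] one needs that [p_n] has subexponential growth on
    [[-1, 1]]; this is where regularity enters. The polynomial
    [F z = z ^ n p_n ((z + 1 / z) / 2)] has no zero in the unit disc and is bounded below there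
    by [c / n], by orthogonality, while [F 0 = gamma_n / 2 ^ n] is subexponential; a discrete
    form of Harnack's inequality, over roots of unity, turns this into an upper bound. *)

(** * Extremal values of linear functionals on polynomials *)

(** For [r <> s] the kernel is not a sum of squares, so no single extremal problem describes it;
    this forces the pairs of functionals. The factors [n ^ r] and [n ^ s] put both derivatives on
    one scale: each normalized Chebyshev polynomial of degree at most [2 n] contributes a bounded
    amount to the extremal value. Changing the degree by [m] then costs [O(m)], and a peak of degree
    [m <= eps n] is affordable after division by [n]. The tension is that such a peak decays only
    like [theta ^ (n / h)], with [theta < 1] and [h] depending on [eps], so it absorbs a growth
    [b ^ n] only for [b] close to 1. Hence [|p_n| <= C b ^ n] is needed for every [b > 1], uniformly
    on the whole of [[-1, 1]]. Harnack's argument works on a circle [|z| = rho < 1], whereas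
    [[-1, 1]] is the image of the unit circle. Since all zeros of [F] lie on the unit circle, going
    from one circle to the other costs a factor at most [(2 / (1 + rho)) ^ (2 n)], whose base tends
    to 1 with [rho]. *)

Section orthonormal_basis.
Context {R : realFieldType} (I : {scalar {poly R}}) (p : nat -> {poly R}).
Hypothesis size_p : forall n, size (p n) = n.+1.
Hypothesis orth_p : forall m n, I (p m * p n) = (m == n)%:R.

Lemma orthonormal_span {n : nat} {P : {poly R}} : (size P <= n)%N ->
  exists c : nat -> R, P = \sum_(k < n) c k *: p k.
Proof.
elim: n P => [|n IHn] P.
  by rewrite leqn0 size_poly_eq0 => /eqP ->; exists (fun=> 0); rewrite big_ord0.
move=> szP; set c0 := P`_n / lead_coef (p n).
have lp0 : lead_coef (p n) != 0.
  by rewrite lead_coef_eq0 -size_poly_eq0 size_p.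
have [|c Pc] := IHn (P - c0 *: p n).
  apply/leq_sizeP => j; rewrite leq_eqVlt => /predU1P[<-|nj].
    by rewrite coefB coefZ /c0 lead_coefE size_p /= mulfVK ?subrr//
         -[n in _`_n]/(n.+1.-1) -(size_p n) -lead_coefE.
  by rewrite coefB coefZ !nth_default ?mulr0 ?subrr// ?size_p// (leq_trans szP).
exists (fun k => if (k < n)%N then c k else c0).
rewrite big_ord_recr/= ltnn -[LHS](subrK (c0 *: p n)) Pc; congr (_ + _).
by apply: eq_bigr => i _; rewrite ltn_ord.
Qed.

Lemma dot_orthonormal (n : nat) (a b : nat -> R) :
  I ((\sum_(k < n) a k *: p k) * (\sum_(k < n) b k *: p k)) =
  \sum_(k < n) a k * b k.
Proof.
rewrite mulr_suml linear_sum; apply: eq_bigr => i _.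
rewrite mulr_sumr linear_sum (bigD1 i)//= big1 => [|j ji].
  rewrite addr0 -scalerAl -scalerAr scalerA linearZ/= orth_p eqxx.
  by rewrite mulr1.
rewrite -scalerAl -scalerAr scalerA linearZ/= orth_p eq_sym.
by rewrite (inj_eq val_inj) (negPf ji) mulr0.
Qed.

Lemma orthonormal_orthogonal (n : nat) (P : {poly R}) : (size P <= n)%N ->
  I (p n * P) = 0.
Proof.
move=> /orthonormal_span[c ->]; rewrite mulr_sumr linear_sum big1// => i _.
by rewrite -scalerAr linearZ/= orth_p gtn_eqF ?mulr0.
Qed.

Lemma cauchy_schwarz_sum (n : nat) (a b : nat -> R) :
  (\sum_(k < n) a k * b k) ^+ 2 <=
  (\sum_(k < n) a k ^+ 2) * (\sum_(k < n) b k ^+ 2).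
Proof.
elim: n => [|n IHn]; first by rewrite !big_ord0 expr2 mul0r.
rewrite !big_ord_recr/=.
set A := \sum_(k < n) a k ^+ 2 in IHn *; set B := \sum_(k < n) b k ^+ 2 in IHn *.
set S := \sum_(k < n) _ in IHn *.
have A0 : 0 <= A by apply: sumr_ge0 => i _; exact: sqr_ge0.
have B0 : 0 <= B by apply: sumr_ge0 => i _; exact: sqr_ge0.
(* By induction the square of the left side is at most [4 A B (a n * b n) ^ 2], hence at most the
   square of the right side by the arithmetic-geometric mean inequality. *)
suff : 2 * S * (a n * b n) <= A * b n ^+ 2 + B * a n ^+ 2 by move=> h; move: IHn h; lra.
have := ler_norm (2 * S * (a n * b n)).
move=> /le_trans; apply.
rewrite -(@ler_pXn2r _ 2)// ?nnegrE ?normr_ge0//; last first.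
  by rewrite addr_ge0// mulr_ge0// sqr_ge0.
rewrite real_normK ?num_real//.
have : 0 <= (A * b n ^+ 2 - B * a n ^+ 2) ^+ 2 by exact: sqr_ge0.
have : 0 <= (A * B - S ^+ 2) * (a n ^+ 2 * b n ^+ 2).
  by apply: mulr_ge0; rewrite ?subr_ge0// mulr_ge0 ?sqr_ge0.
lra.
Qed.

(* The extremal value: sup of [l P ^ 2 / I (P ^ 2)] over polynomials of degree
   less than [n]; for [l] an evaluation it is the inverse Christoffel
   function. *)
Definition christoffel (l : {poly R} -> R) (n : nat) : R :=
  \sum_(k < n) l (p k) ^+ 2.

Lemma christoffel_ge0 l n : 0 <= christoffel l n.
Proof. by apply: sumr_ge0 => k _; exact: sqr_ge0. Qed.

Lemma christoffel_upper (l : {scalar {poly R}}) n (P : {poly R}) :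
  (size P <= n)%N -> l P ^+ 2 <= christoffel l n * I (P ^+ 2).
Proof.
move=> /orthonormal_span[c ->]; rewrite expr2 dot_orthonormal linear_sum.
under eq_bigr do rewrite linearZ/= mulrC.
under [X in _ <= _ * X]eq_bigr do rewrite -expr2.
exact: (cauchy_schwarz_sum n (fun k => l (p k)) c).
Qed.

(** The polynomial representing [l] for the inner product [I (P * Q)] in degree less than [n]. It
    attains the supremum, as its image under [l] and its squared norm are both the extremal
    value. *)
Definition kernel_poly (l : {poly R} -> R) (n : nat) : {poly R} :=
  \sum_(k < n) l (p k) *: p k.

Lemma kernel_polyE (l : {scalar {poly R}}) n :
  l (kernel_poly l n) = christoffel l n.
Proof. by rewrite linear_sum; apply: eq_bigr => k _; rewrite linearZ expr2. Qed.

Lemma norm_kernel_poly (l : {poly R} -> R) n :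
  I (kernel_poly l n ^+ 2) = christoffel l n.
Proof.
by rewrite expr2 (dot_orthonormal n (fun k => l (p k)) (fun k => l (p k))).
Qed.

Lemma size_kernel_poly (l : {poly R} -> R) n : (size (kernel_poly l n) <= n)%N.
Proof.
apply: (leq_trans (size_sum _ _ _)); apply/bigmax_leqP => i _.
by rewrite (leq_trans (size_scale_leq _ _))// size_p.
Qed.

End orthonormal_basis.

(** * Chebyshev polynomials and their derivatives *)

Section chebyshev.
Context {R : comNzRingType}.

(* With [x = cos t], [cheb k] is the pair [cos (k t)], [sin (k t) / sin t]
   of Chebyshev polynomials of the first and (shifted) second kind. *)
Fixpoint cheb (k : nat) : {poly R} * {poly R} :=
  if k is k'.+1 then
    let: (t, v) := cheb k' in ('X * t - (1 - 'X ^+ 2) * v, t + 'X * v)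
  else (1, 0).

Definition chebT k := (cheb k).1.
Definition chebV k := (cheb k).2.

Lemma chebTS k : chebT k.+1 = 'X * chebT k - (1 - 'X ^+ 2) * chebV k.
Proof. by rewrite /chebT /chebV /=; case: (cheb k). Qed.

Lemma chebVS k : chebV k.+1 = chebT k + 'X * chebV k.
Proof. by rewrite /chebT /chebV /=; case: (cheb k). Qed.

Lemma chebT0 : chebT 0 = 1. Proof. by []. Qed.
Lemma chebV0 : chebV 0 = 0. Proof. by []. Qed.

Lemma chebVSS k : chebV k.+2 = 2%:R * 'X * chebV k.+1 - chebV k.
Proof. by rewrite (chebVS k.+1) chebTS chebVS; ring. Qed.

Lemma cheb_deriv k :
  (chebT k)^`() = k%:R * chebV k /\
  (1 - 'X ^+ 2) * (chebV k)^`() = 'X * chebV k - k%:R * chebT k.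
Proof.
elim: k => [|k [dT dV]].
  by rewrite chebT0 chebV0 derivC deriv0; split; ring.
have d1 : (1 - 'X ^+ 2 : {poly R})^`() = - (2%:R * 'X).
  by rewrite derivB derivC derivXn expr1 sub0r mulr_natl.
rewrite !chebTS !chebVS derivB !derivM d1 derivD derivM !derivX dT; split.
  rewrite dV; ring.
transitivity ((1 - 'X ^+ 2) * (k%:R * chebV k + chebV k) +
  'X * ((1 - 'X ^+ 2) * (chebV k)^`())); first by ring.
by rewrite dV; ring.
Qed.

Lemma chebT_ode k j :
  (1 - 'X ^+ 2) * (chebT k)^`(j.+2) =
  (2 * j + 1)%:R * 'X * (chebT k)^`(j.+1) + (j%:R ^+ 2 - k%:R ^+ 2) * (chebT k)^`(j).
Proof.
have d1 : (1 - 'X ^+ 2 : {poly R})^`() = - (2%:R * 'X).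
  by rewrite derivB derivC derivXn expr1 sub0r mulr_natl.
have dn (n : nat) : (n%:R : {poly R})^`() = 0 by rewrite -polyC_natr derivC.
elim: j => [|j IHj].
  have [dT dV] := cheb_deriv k.
  rewrite !derivnS derivn0 dT derivM dn mul0r add0r mulrCA dV; ring.
have := congr1 (@deriv R) IHj.
rewrite derivM d1 derivD !derivM derivX dn derivB -!natrX !dn.
rewrite -!derivnS => h.
apply: (addrI (- (2%:R * 'X) * (chebT k)^`(j.+2))); rewrite h; ring.
Qed.

Lemma size_cheb k : (size (chebT k) <= k.+1)%N /\ (size (chebV k) <= k)%N.
Proof.
elim: k => [|k [sT sV]]; first by rewrite chebT0 chebV0 size_poly0 size_poly1.
have sXT : (size ('X * chebT k)%R <= k.+2)%N.
  by rewrite (leq_trans (size_mul_leq _ _))// size_polyX.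
have sXV : (size ('X * chebV k)%R <= k.+1)%N.
  by rewrite (leq_trans (size_mul_leq _ _))// size_polyX.
have s1 : (size (1 - 'X ^+ 2 : {poly R})%R <= 3)%N.
  rewrite (leq_trans (size_polyD _ _))// size_polyN size_polyXn size_poly1.
  by [].
rewrite chebTS chebVS; split.
  rewrite (leq_trans (size_polyD _ _))// size_polyN geq_max sXT.
  rewrite (leq_trans (size_mul_leq _ _))//.
  by rewrite -subn1 leq_subLR add1n (leq_trans (leq_add s1 sV))// add3n.
by rewrite (leq_trans (size_polyD _ _))// geq_max sT sXV.
Qed.
End chebyshev.

(** In the recursion, ['X ^+ 2 * chebV k] adds the top coefficient of [chebV k] to that of
    [chebT k]; positivity propagates once nonnegativity of the former is carried along. This fixes
    the exact degree. *)
Lemma chebT_coef_gt0 {R : realDomainType} k : 0 < (chebT k : {poly R})`_k.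
Proof.
suff : 0 < (chebT k : {poly R})`_k /\ 0 <= ('X * chebV k : {poly R})`_k by case.
elim: k => [|k [T0 V0]]; first by rewrite chebT0 chebV0 mulr0 coefC coef0.
have sV := (size_cheb (R := R) k.+1).2.
rewrite coefXM/= chebVS coefD; split; last by rewrite addr_ge0// ltW.
rewrite chebTS mulrBl mul1r coefB coefB coefXM/= coefXnM.
rewrite [X in _ - (X - _)]nth_default ?sub0r; last first.
  by rewrite (leq_trans (size_cheb k).2).
rewrite opprK; move: V0; rewrite coefXM; case: k T0 sV => [|k] T0 sV /= V0.
  by rewrite addr0.
by rewrite !subSS subn0 ltr_wpDr.
Qed.

Lemma size_chebT {R : realDomainType} k : size (chebT k : {poly R}) = k.+1.
Proof.
apply/eqP; rewrite eqn_leq (size_cheb k).1/= ltnNge; apply/negP => h.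
by have := @chebT_coef_gt0 R k; rewrite nth_default ?ltxx.
Qed.

Section chebyshev_trig.
Context {R : realType}.
Implicit Types t x : R.

Lemma cheb_cos k t : (chebT k).[cos t] = cos (k%:R * t) /\
  (chebV k).[cos t] * sin t = sin (k%:R * t).
Proof.
elim: k => [|k [hT hV]].
  by rewrite chebT0 chebV0 !hornerE cos0 sin0.
have s2 : 1 - cos t ^+ 2 = sin t ^+ 2 by rewrite sin2cos2.
have -> : k.+1%:R * t = k%:R * t + t by rewrite -natr1 mulrDl mul1r.
rewrite chebTS chebVS cosD sinD -hT -hV !hornerE; split.
  by rewrite s2; ring.
by ring.
Qed.

Lemma cos_acosK x : -1 <= x <= 1 -> cos (acos x) = x.
Proof. by move=> x1; rewrite acosK// in_itv. Qed.

Lemma norm_chebT_le1 k x : -1 <= x <= 1 -> `|(chebT k).[x]| <= 1.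
Proof.
by move=> /cos_acosK <-; rewrite (cheb_cos _ _).1 ler_norml cos_geN1 cos_le1.
Qed.

Lemma norm_chebV_le k x : -1 <= x <= 1 -> `|(chebV k).[x]| <= k%:R.
Proof.
move=> x1; elim: k => [|k IHk]; first by rewrite chebV0 horner0 normr0.
rewrite chebVS hornerD -natr1 addrC (le_trans (ler_normD _ _))//.
rewrite lerD ?norm_chebT_le1// hornerM hornerX normrM (le_trans _ IHk)//.
by rewrite ler_piMl// ler_norml.
Qed.

End chebyshev_trig.

(** * Asymptotics of the derivatives of Chebyshev polynomials *)

Section chebyshev_asymptotics.
Context {R : realType}.
Implicit Types t x y : R.

(* [phase j y] is [cos (y - j * pi / 2)]. *)
Fixpoint phase (j : nat) (y : R) : R :=
  match j with 0 => cos y | 1 => sin y | j'.+2 => - phase j' y end.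

Lemma norm_phase_le1 j y : `|phase j y| <= 1.
Proof.
suff : `|phase j y| <= 1 /\ `|phase j.+1 y| <= 1 by case.
elim: j => [|j [IH0 IH1]] /=.
  by rewrite !ler_norml cos_geN1 cos_le1 sin_geN1 sin_le1.
by rewrite normrN.
Qed.

Lemma pred_mul_expn_le j k : (j.-1 * k ^ j.-1 <= j.-1 * k ^ j)%N.
Proof.
case: j => [//|j] /=; case: k => [|k]; last by rewrite leq_mul2l leq_pexp2l ?orbT.
by case: j => [//|j]; rewrite !exp0n.
Qed.

(* The induction on [j] is two-step, through the derivatives of Chebyshev's equation
   [(1 - x ^ 2) T'' - x T' + k ^ 2 T = 0]. *)
Lemma chebT_deriv_phase (j : nat) (s0 : R) : 0 < s0 -> exists2 C : R, 0 <= C &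
  forall k t, s0 <= sin t ->
    `|(chebT k)^`(j).[cos t] * sin t ^+ j - k%:R ^+ j * phase j (k%:R * t)|
    <= C * (j.-1 * k ^ j.-1)%:R.
Proof.
move=> s0_gt0.
(* The factor [j.-1] makes the approximation exact for [j = 0] and [j = 1], which are the two base
   cases. *)
pose bound j C := forall k t, s0 <= sin t ->
    `|(chebT k)^`(j).[cos t] * sin t ^+ j - k%:R ^+ j * phase j (k%:R * t)|
    <= C * (j.-1 * k ^ j.-1)%:R.
suff : (exists2 C, 0 <= C & bound j C) /\ (exists2 C, 0 <= C & bound j.+1 C).
  by case.
elim: j => [|j [[C0 C0_ge0 IH0] [C1 C1_ge0 IH1]]].
  split; exists 0 => // k t _; rewrite mul0r normr_le0.
    by rewrite derivn0 (cheb_cos k t).1 !expr0 /= mulr1 mul1r subrr.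
  rewrite derivn1 (cheb_deriv k).1 !expr1 hornerM -mulrA (cheb_cos k t).2.
  by rewrite -polyC_natr hornerC subrr.
split; first by exists C1.
have main (i : nat) (C : R) k t : 0 <= C -> bound i C -> s0 <= sin t ->
    `|(chebT k)^`(i).[cos t] * sin t ^+ i| <= (C * i%:R + 1) * k%:R ^+ i.
  move=> C_ge0 b st; rewrite -[X in `|X|](subrK (k%:R ^+ i * phase i (k%:R * t))).
  rewrite (le_trans (ler_normD _ _))// mulrDl mul1r lerD//.
    rewrite (le_trans (b k t st))// -mulrA ler_wpM2l// -natrX -natrM ler_nat.
    by rewrite (leq_trans (pred_mul_expn_le i k))// leq_mul2r leq_pred orbT.
  by rewrite normrM normrX normr_nat ler_piMr ?norm_phase_le1// exprn_ge0.
(* One summand for each term left by Chebyshev's equation: the derivative of order [j + 1], the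
   coefficient [j ^ 2], and [k ^ 2] times the error at order [j]. The main terms cancel because
   [phase j.+2] is [- phase j]. *)
pose C : R := (2 * j + 1)%:R * (C1 * j.+1%:R + 1) / s0 +
   j%:R ^+ 2 * (C0 * j%:R + 1) + C0 * j%:R.
have s0V : 0 <= s0^-1 by rewrite invr_ge0 ltW.
have C1' : 0 <= C1 * j.+1%:R + 1 by rewrite addr_ge0// mulr_ge0.
have C0' : 0 <= C0 * j%:R + 1 by rewrite addr_ge0// mulr_ge0.
have C_ge0 : 0 <= C by rewrite !addr_ge0 ?mulr_ge0.
exists C => // k t st; have s_gt0 : 0 < sin t by exact: lt_le_trans st.
have ode := congr1 (fun P => P.[cos t]) (chebT_ode k j).
rewrite !hornerE -!polyC_natr !hornerE in ode.
have s2 : 1 - cos t ^+ 2 = sin t ^+ 2 by rewrite sin2cos2.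
move: ode; rewrite s2 => ode.
set D2 := (X in `|X|).
set A1 := (chebT k)^`(j.+1).[cos t]; set A0 := (chebT k)^`(j).[cos t].
have -> : D2 = (2 * j + 1)%:R * cos t * (A1 * sin t ^+ j.+1) / sin t +
   j%:R ^+ 2 * (A0 * sin t ^+ j) -
   k%:R ^+ 2 * (A0 * sin t ^+ j - k%:R ^+ j * phase j (k%:R * t)).
  transitivity ((sin t ^+ 2 * (chebT k)^`(j.+2).[cos t]) * sin t ^+ j +
      k%:R ^+ j.+2 * phase j (k%:R * t)); last first.
    rewrite ode -/A0 -/A1 !exprS; field; exact: lt0r_neq0.
  by rewrite /D2 /= !exprS; ring.
have b1 := main j.+1 C1 k t C1_ge0 IH1 st; rewrite -/A1 in b1.
have b0 := main j C0 k t C0_ge0 IH0 st; rewrite -/A0 in b0.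
have d0 := IH0 k t st; rewrite -/A0 in d0.
rewrite (le_trans (ler_normB _ _))// (le_trans (lerD (ler_normD _ _) (lexx _)))//.
have kj : (j%:R * k%:R ^+ j : R) <= j%:R * k%:R ^+ j.+1.
  by rewrite -!natrX -!natrM ler_nat; exact: (pred_mul_expn_le j.+1 k).
apply: (@le_trans _ _ (C * k%:R ^+ j.+1)); last first.
  rewrite ler_wpM2l//= -natrX ler_nat leq_pmull//.

have k_ge0 : 0 <= k%:R :> R by [].
have cos1 : `|cos t| <= 1 by rewrite ler_norml cos_geN1 cos_le1.
rewrite !mulrDl; apply: lerD; first apply: lerD.
- have e1 : `|cos t| * `|A1 * sin t ^+ j.+1| <= (C1 * j.+1%:R + 1) * k%:R ^+ j.+1.
    by rewrite (le_trans _ b1)// ler_piMl.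
  have e2 : (sin t)^-1 <= s0^-1 by rewrite lef_pV2// posrE.
  rewrite 3!normrM normfV normr_nat (gtr0_norm s_gt0) -mulrA -mulrA.
  rewrite -[leRHS]mulrA -[leRHS]mulrA; apply: ler_wpM2l => //.
  rewrite [leRHS]mulrA [leRHS]mulrAC mulrA.
  by apply: ler_pM; rewrite ?mulr_ge0 ?invr_ge0 ?(ltW s_gt0).
- rewrite normrM normrX normr_nat.
  apply: (@le_trans _ _ (j%:R ^+ 2 * ((C0 * j%:R + 1) * k%:R ^+ j))).
    by apply: ler_wpM2l; rewrite ?exprn_ge0.
  rewrite expr2 -!mulrA ler_wpM2l// mulrCA [leRHS]mulrCA.
  by apply: ler_wpM2l => //; rewrite mulrC.
- rewrite normrM normrX normr_nat.
  apply: (@le_trans _ _ (k%:R ^+ 2 * (C0 * (j.-1 * k ^ j.-1)%:R))).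
    by apply: ler_wpM2l; rewrite ?exprn_ge0.
  rewrite mulrCA -[leRHS]mulrA; apply: ler_wpM2l => //.
  rewrite -!natrX -!natrM ler_nat; case: (j) => [|i]; first by rewrite mul0n muln0.
  by rewrite /= mulnCA leq_mul// -expnD add2n.
Qed.

(** Summation by parts: beyond the boundary term [a n * g n], what remains is [a 0 * g 0] and the
    increments of [a] against [g], of total size at most [a n] by monotonicity. *)
Lemma abel_sum_le (a g : nat -> R) n : {homo a : i j / (i <= j)%N >-> i <= j} ->
  0 <= a 0%N -> (forall k, `|g k| <= 1) ->
  `|\sum_(k < n) a k * (g k.+1 - g k)| <= 2 * a n.
Proof.
move=> a_mono a0 g1; have a_ge0 k : 0 <= a k by rewrite (le_trans a0)// a_mono.
suff h : `|\sum_(k < n) a k * (g k.+1 - g k) - a n * g n| <= a n.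
  rewrite -[X in `|X|](subrK (a n * g n)) (le_trans (ler_normD _ _))//.
  by rewrite mulr_natl mulr2n lerD// normrM ger0_norm// ler_piMr.
elim: n => [|n IHn].
  by rewrite big_ord0 sub0r normrN normrM ger0_norm// ler_piMr.
rewrite big_ord_recr/=; set S := \sum_(_ < _) _ in IHn *.
rewrite (_ : _ - _ = (S - a n * g n) - (a n.+1 - a n) * g n.+1); last by ring.
rewrite (le_trans (ler_normB _ _))// -[leRHS](subrKC (a n)) lerD//.
have an : a n <= a n.+1 by rewrite a_mono.
by rewrite normrM ger0_norm ?subr_ge0// ler_piMr// subr_ge0.
Qed.

(** The difference [(k + 1) ^ (m + 1) - k ^ (m + 1)] factors into a sum of [m + 1] products lying
    between [k ^ m] and [(k + 1) ^ m]; both bounds telescope. *)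
Lemma sum_expn_bounds (m n : nat) :
  \sum_(k < n) (k%:R : R) ^+ m <= n%:R ^+ m.+1 / m.+1%:R /\
  n%:R ^+ m.+1 / m.+1%:R <= \sum_(k < n) (k%:R : R) ^+ m + n%:R ^+ m.
Proof.
have step k : (k%:R ^+ m <= (k.+1%:R ^+ m.+1 - k%:R ^+ m.+1) / m.+1%:R :> R) /\
    ((k.+1%:R ^+ m.+1 - k%:R ^+ m.+1) / m.+1%:R <= k.+1%:R ^+ m :> R).
  have kS : (k%:R <= k.+1%:R :> R) by rewrite ler_nat.
  have split_exp (y : R) (i : 'I_m.+1) : y ^+ m = y ^+ (m - i) * y ^+ i.
    by rewrite -exprD subnK// -ltnS.
  rewrite ler_pdivlMr ?ltr0n// ler_pdivrMr ?ltr0n// subrXX -natrB// subSnn mul1r.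
  rewrite !mulr_natr -[X in _ *+ X <= _ /\ _](card_ord m.+1)
    -[X in _ /\ _ <= _ *+ X](card_ord m.+1) -!sumr_const.
  split; apply: ler_sum => i _; rewrite /= ?subSS (split_exp _ i).
    by rewrite ler_wpM2r ?exprn_ge0// lerXn2r// nnegrE.
  by rewrite ler_wpM2l ?exprn_ge0// lerXn2r// nnegrE.
elim: n => [|n [IH1 IH2]].
  rewrite !big_ord0 exprS !mul0r add0r; split => //.
rewrite !big_ord_recr/=.
have [s1 s2] := step n.
rewrite (_ : n.+1%:R ^+ m.+1 / m.+1%:R = n%:R ^+ m.+1 / m.+1%:R +
  (n.+1%:R ^+ m.+1 - n%:R ^+ m.+1) / m.+1%:R); last by rewrite -mulrDl addrC subrK.
split; first by rewrite lerD.
by rewrite lerD.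
Qed.

Lemma chebT_deriv_le (j : nat) (s0 : R) : 0 < s0 -> exists2 B : R, 0 <= B &
  forall k t, s0 <= sin t ->
    `|(chebT k)^`(j).[cos t] * sin t ^+ j| <= B * k%:R ^+ j.
Proof.
move=> /(chebT_deriv_phase j)[C C_ge0 hC]; exists (C * j%:R + 1).
  by rewrite addr_ge0// mulr_ge0.
move=> k t st; rewrite -[X in `|X|](subrK (k%:R ^+ j * phase j (k%:R * t))).
rewrite (le_trans (ler_normD _ _))// mulrDl mul1r lerD//.
  rewrite (le_trans (hC k t st))// -mulrA ler_wpM2l// -natrX -natrM ler_nat.
  by rewrite (leq_trans (pred_mul_expn_le j k))// leq_mul2r leq_pred orbT.
by rewrite normrM normrX normr_nat ler_piMr ?norm_phase_le1// exprn_ge0.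
Qed.

(** This is [cos ((r - s) * pi / 2)], the mean value of [2 * phase r y * phase s y] over [y]. *)
Definition phase_sign (r s : nat) : R :=
  if odd (r + s) then 0 else (-1) ^ ((r%:Z - s%:Z) %/ 2)%Z.

Lemma tau_phase_sign r s : tau R r s = phase_sign r s / (r + s + 1)%:R.
Proof. by rewrite /tau /phase_sign; case: ifP => _; rewrite ?mul0r. Qed.

Lemma phase_signSSl r s : phase_sign r.+2 s = - phase_sign r s.
Proof.
rewrite /phase_sign !addSn /= negbK; case: ifP => _; first by rewrite oppr0.
have -> : (r.+2%:Z - s%:Z = 1 * 2 + (r%:Z - s%:Z))%R by rewrite -addn2 PoszD; ring.
by rewrite divzMDl// addrC exprzDr ?unitrN1// expr1z mulrN1.
Qed.

Lemma phase_signSSr r s : phase_sign r s.+2 = - phase_sign r s.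
Proof.
apply: oppr_inj; rewrite opprK -phase_signSSl /phase_sign !addSn !addnS /= !negbK.
by have -> : (r.+2%:Z - s.+2%:Z = r%:Z - s%:Z)%R by rewrite -[r.+2]addn2 -[s.+2]addn2 !PoszD; ring.
Qed.

Lemma norm_phase_sign_le1 r s : `|phase_sign r s| <= 1.
Proof.
rewrite /phase_sign; case: ifP => _; first by rewrite normr0.
by case: (_ %/ _)%Z => n; rewrite ?NegzE ?exprnN ?normfV normrX normrN1 expr1n ?invr1.
Qed.

(** Product-to-sum formula: the oscillating part is [cos (2 y - (r + s) pi / 2)], whose coefficients
    [al] and [be] enter later only through their size. Raising an index by 2 changes all signs, so
    four base cases suffice. *)
Lemma phase_product r s : exists al be : R, [/\ `|al| <= 1, `|be| <= 1 &
  forall y, 2 * (phase r y * phase s y) =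
            phase_sign r s + al * cos (y + y) + be * sin (y + y)].
Proof.
have c2 y : cos (y + y) = 2 * cos y ^+ 2 - 1.
  by rewrite cosD; have := cos2Dsin2 y; rewrite !expr2; lra.
have s2 y : sin (y + y) = 2 * (sin y * cos y) by rewrite sinD; lra.
pose Q r s := exists al be : R, [/\ `|al| <= 1, `|be| <= 1 &
  forall y, 2 * (phase r y * phase s y) =
            phase_sign r s + al * cos (y + y) + be * sin (y + y)].
have QSSl r' s' : Q r' s' -> Q r'.+2 s'.
  move=> [al [be [al1 be1 e]]]; exists (- al), (- be); rewrite !normrN; split => // y.
  by rewrite phase_signSSl /= mulNr mulrN e; ring.
have QSSr r' s' : Q r' s' -> Q r' s'.+2.
  move=> [al [be [al1 be1 e]]]; exists (- al), (- be); rewrite !normrN; split => // y.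
  by rewrite phase_signSSr /= mulrN mulrN e; ring.
have n1 : `|1 : R| <= 1 by rewrite normr1.
have n0 : `|0 : R| <= 1 by rewrite normr0.
have Q0 s' : Q 0 s' /\ Q 0 s'.+1.
  elim: s' => [|s' [h0 h1]]; last by split => //; exact: QSSr.
  split; [exists 1, 0|exists 0, 1]; split => // y; rewrite /phase_sign/= ?c2 ?s2.
    by rewrite subrr div0z expr0z; ring.
  by ring.
have Q1 s' : Q 1 s' /\ Q 1 s'.+1.
  elim: s' => [|s' [h0 h1]]; last by split => //; exact: QSSr.
  split; [exists 0, 1|exists (-1), 0]; split; rewrite ?normrN// => y.
    by rewrite /phase_sign/= s2; ring.
  rewrite /phase_sign/= c2 subrr div0z expr0z.
  by have := cos2Dsin2 y; rewrite !expr2; lra.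
suff : Q r s /\ Q r.+1 s by case.
elim: r => [|r [h0 h1]]; last by split => //; exact: QSSl.
by split; [exact: (Q0 s).1|exact: (Q1 s).1].
Qed.
End chebyshev_asymptotics.

(** * Diagonal kernels of the arcsine measure *)

Section chebyshev_kernel.
Context {R : realType}.
Implicit Types t x y : R.

(** Under the arcsine probability measure [chebT k] has squared norm 1 for [k = 0] and 1/2
    otherwise. *)
Definition chebN k : {poly R} := (if k == 0%N then 1 else Num.sqrt 2) *: chebT k.

(** Multiplied by [2 sin t], the values [cos (2 k t)] and [sin (2 k t)] become differences of
    consecutive terms of a sequence bounded by 1, to which Abel summation applies; [s0] keeps
    [sin t] away from 0. *)
Lemma sum_expn_trig_le (m : nat) (t s0 : R) (n : nat) : 0 < s0 -> s0 <= sin t ->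
  `|\sum_(k < n) k%:R ^+ m * cos (k%:R * t + k%:R * t)| <= n%:R ^+ m / s0 /\
  `|\sum_(k < n) k%:R ^+ m * sin (k%:R * t + k%:R * t)| <= n%:R ^+ m / s0.
Proof.
move=> s0_gt0 st; have s_gt0 : 0 < sin t by exact: lt_le_trans st.
have mono : {homo (fun k => k%:R ^+ m : R) : i j / (i <= j)%N >-> i <= j}.
  by move=> i j ij; rewrite lerXn2r ?nnegrE// ler_nat.
have fin (f : nat -> R) (g : nat -> R) : (forall k, `|g k| <= 1) ->
    (forall k, 2 * sin t * f k = g k.+1 - g k) ->
    `|\sum_(k < n) k%:R ^+ m * f k| <= n%:R ^+ m / s0.
  move=> g1 fg; rewrite ler_pdivlMr//.
  have := abel_sum_le _ _ n mono (exprn_ge0 m (ler0n _ 0)) g1.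
  under eq_bigr do rewrite -fg mulrCA.
  rewrite -mulr_sumr normrM ger0_norm; last by rewrite mulr_ge0// ltW.
  rewrite -mulrA ler_pM2l// => /(le_trans _) h; apply: h.
  by rewrite mulrC ler_wpM2r.
have e k : k.+1%:R * t + k.+1%:R * t - t = (k%:R * t + k%:R * t) + t.
  by rewrite -natr1; ring.
split.
  apply: (fin (fun k => cos (k%:R * t + k%:R * t)) (fun k => sin (k%:R * t + k%:R * t - t))) => k.
    by rewrite ler_norml sin_geN1 sin_le1.
  by rewrite e sinD sinB; ring.
apply: (fin (fun k => sin (k%:R * t + k%:R * t)) (fun k => - cos (k%:R * t + k%:R * t - t))) => k.
  by rewrite normrN ler_norml cos_geN1 cos_le1.
by rewrite e cosD cosB; ring.
Qed.

(** The index 0 is given the weight 2 of all other indices, and the excess is removed. *)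
Lemma cheb_kernel_diagE r s n x : (0 < n)%N ->
  cd_kernel_diag chebN r s n x =
  \sum_(k < n) 2 * ((chebT k)^`(r).[x] * (chebT k)^`(s).[x]) -
  (chebT 0)^`(r).[x] * (chebT 0)^`(s).[x].
Proof.
case: n => // n _; rewrite /cd_kernel_diag !big_ord_recl /chebN/= !scale1r.
rewrite mulr_natl mulr2n -!addrA; congr (_ + _).
rewrite addrC subrK; apply: eq_bigr => i _ /=.
rewrite !derivnZ !hornerZ mulrACA -expr2 sqr_sqrtr//.
Qed.

Lemma cheb_kernel_asymptotics (r s : nat) (s0 : R) : 0 < s0 ->
  exists2 C : R, 0 <= C & forall n x, (0 < n)%N -> -1 <= x <= 1 ->
    s0 <= Num.sqrt (1 - x ^+ 2) ->
    `|Num.sqrt (1 - x ^+ 2) ^+ (r + s) * cd_kernel_diag chebN r s n x -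
      n%:R ^+ (r + s + 1) * tau R r s| <= C * n%:R ^+ (r + s).
Proof.
move=> s0_gt0.
have [Cr Cr0 hCr] := chebT_deriv_phase r s0 s0_gt0.
have [Cs Cs0 hCs] := chebT_deriv_phase s s0 s0_gt0.
have [Br Br0 hBr] := chebT_deriv_le r s0 s0_gt0.
have [Bs Bs0 hBs] := chebT_deriv_le s s0 s0_gt0.
have [al [be [al1 be1 hph]]] := phase_product (R := R) r s.
(* The two factors are replaced one at a time: the error of the first against the bound [Bs] of the
   second, then the first phase term, at most [k ^ r], against the error of the second. *)
pose D := Cr * r.-1%:R * Bs + Cs * s.-1%:R.
have D0 : 0 <= D by rewrite /D addr_ge0 ?mulr_ge0.
exists (1 + 2 * s0^-1 + 2 * D + Br * Bs).
  by rewrite !addr_ge0 ?mulr_ge0 ?invr_ge0 ?(ltW s0_gt0).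
move=> n x n0 x1; rewrite -sin_acos//; set t := acos x => st.
have xt : x = cos t by rewrite cos_acosK.
pose a j k := (chebT k)^`(j).[cos t] * sin t ^+ j.
pose ph k := phase r (k%:R * t) * phase s (k%:R * t).
have -> : sin t ^+ (r + s) * cd_kernel_diag chebN r s n x =
    \sum_(k < n) k%:R ^+ (r + s) * (2 * ph k) +
    \sum_(k < n) 2 * (a r k * a s k - k%:R ^+ (r + s) * ph k) -
    a r 0%N * a s 0%N.
  rewrite cheb_kernel_diagE// mulrBr mulr_sumr -big_split xt; congr (_ - _).
    by apply: eq_bigr => k _; rewrite /a exprD /=; ring.
  by rewrite /a exprD; ring.
have e1 : `|\sum_(k < n) k%:R ^+ (r + s) * (2 * ph k) -
     n%:R ^+ (r + s + 1) * tau R r s| <= (1 + 2 * s0^-1) * n%:R ^+ (r + s).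
  have [b1 b2] := sum_expn_trig_le (r + s) t s0 n s0_gt0 st.
  have [l1 l2] := sum_expn_bounds (R := R) (r + s) n.
  under eq_bigr do rewrite hph !mulrDr.
  rewrite !big_split/= -mulr_suml.
  set S := \sum_(k < n) _ in l1 l2 *.
  set S1 := \sum_(k < n) _; set S2 := \sum_(k < n) _.
  have -> : S * phase_sign r s + S1 + S2 - n%:R ^+ (r + s + 1) * tau R r s =
     (S - n%:R ^+ (r + s).+1 / (r + s).+1%:R) * phase_sign r s + (S1 + S2).
    by rewrite tau_phase_sign addn1; ring.
  rewrite (le_trans (ler_normD _ _))// [leRHS]mulrDl mul1r lerD//.
    rewrite normrM (le_trans (ler_piMr _ (norm_phase_sign_le1 r s)))//.
    by rewrite distrC ger0_norm ?subr_ge0// lerBlDl.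
  rewrite (le_trans (ler_normD _ _))// mulr_natl mulr2n [leRHS]mulrDl.
  have sc (ga : R) (f : nat -> R) : `|ga| <= 1 ->
      `|\sum_(k < n) k%:R ^+ (r + s) * f k| <= n%:R ^+ (r + s) / s0 ->
      `|\sum_(k < n) k%:R ^+ (r + s) * (ga * f k)| <= s0^-1 * n%:R ^+ (r + s).
    move=> ga1 hf; under eq_bigr do rewrite mulrCA.
    by rewrite -mulr_sumr normrM mulrC (le_trans (ler_piMr _ ga1))// mulrC.
  apply: lerD; first exact: (sc al (fun k => cos (k%:R * t + k%:R * t))).
  exact: (sc be (fun k => sin (k%:R * t + k%:R * t))).
have e2 : `|\sum_(k < n) 2 * (a r k * a s k - k%:R ^+ (r + s) * ph k)| <=
    2 * D * n%:R ^+ (r + s).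
  have nR : 0 < n%:R :> R by rewrite ltr0n.
  have ek (k : 'I_n) : `|2 * (a r k * a s k - k%:R ^+ (r + s) * ph k)| <=
      2 * D * n%:R ^+ (r + s) / n%:R.
    have kn : (k <= n)%N by exact: ltnW.
    rewrite normrM normr_nat -!(mulrA 2) -mulrA ler_wpM2l// [leRHS]mulrA ler_pdivlMr//.
    have -> : a r k * a s k - k%:R ^+ (r + s) * ph k =
        (a r k - k%:R ^+ r * phase r (k%:R * t)) * a s k +
        k%:R ^+ r * phase r (k%:R * t) * (a s k - k%:R ^+ s * phase s (k%:R * t)).
      by rewrite /ph exprD; ring.
    apply: (@le_trans _ _ ((Cr * (r.-1 * k ^ r.-1)%:R * (Bs * k%:R ^+ s) +
        k%:R ^+ r * (Cs * (s.-1 * k ^ s.-1)%:R)) * n%:R)).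
      rewrite ler_wpM2r// (le_trans (ler_normD _ _))// lerD//.
        by rewrite normrM ler_pM ?hBs ?hCr.
      rewrite !normrM normrX normr_nat -mulrA ler_wpM2l ?exprn_ge0//.
      by rewrite (le_trans (ler_piMl _ (norm_phase_le1 _ _)))// hCs.
    rewrite /D !mulrDl -!natrX !natrM; apply: lerD.
      rewrite (_ : _ * _ = Cr * r.-1%:R * Bs * ((k ^ r.-1)%:R * (k ^ s)%:R * n%:R)); last by ring.
      case: (r) => [|[|r']]; rewrite ?mulr0 ?mul0r//=.
      rewrite ler_wpM2l ?mulr_ge0// -!natrM ler_nat !addSn [(n ^ _)%N]expnS mulnC.
      by rewrite leq_mul// -expnD leq_exp2r// addnC.
    rewrite (_ : _ * _ = Cs * s.-1%:R * ((k ^ s.-1)%:R * (k ^ r)%:R * n%:R)); last by ring.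
    case: (s) => [|[|s']]; rewrite ?mulr0 ?mul0r//=.
    rewrite ler_wpM2l ?mulr_ge0// -!natrM ler_nat !addnS [(n ^ _)%N]expnS mulnC.
    by rewrite leq_mul// -expnD addnC addnS leq_exp2r.
  rewrite (le_trans (ler_norm_sum _ _ _))// (le_trans (ler_sum _ (fun k _ => ek k)))//.
  by rewrite sumr_const card_ord -[leLHS]mulr_natr mulfVK// gt_eqF.
have e3 : `|a r 0%N * a s 0%N| <= Br * Bs * n%:R ^+ (r + s).
  rewrite normrM (@le_trans _ _ ((Br * 0%:R ^+ r) * (Bs * 0%:R ^+ s)))//.
    by rewrite ler_pM ?hBr ?hBs.
  by rewrite mulrACA -exprD ler_wpM2l ?mulr_ge0// lerXn2r ?nnegrE ?ler0n.
set S := \sum_(k < n) _ in e1 *; set T := \sum_(k < n) _ in e2 *.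
rewrite [X in `|X|](_ : _ = (S - n%:R ^+ (r + s + 1) * tau R r s) + T - a r 0%N * a s 0%N);
  last by ring.
rewrite (le_trans (ler_normB _ _))// [leRHS]mulrDl lerD//.
by rewrite (le_trans (ler_normD _ _))// [leRHS]mulrDl lerD.
Qed.
End chebyshev_kernel.

(** * Integration against mu and the Chebyshev weight *)

Section density.
Context {R : realType} (mu : {finite_measure set (measurableTypeR R) -> \bar R}).
Local Notation leb := (@lebesgue_measure R).

(** Restricted to [D], [mu] is dominated by Lebesgue measure, and its Radon-Nikodym derivative
    agrees with [w] almost everywhere on [D] because both have the same integral over every
    measurable subset. *)
Lemma integral_density (D : set (measurableTypeR R)) (f w : measurableTypeR R -> R) : measurable D ->
  leb.-integrable D (EFin \o w) ->
  (forall A : set (measurableTypeR R), measurable A -> A `<=` D ->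
     mu A = (\int[leb]_(x in A) (w x)%:E)%E) ->
  (forall x, 0 <= f x) -> measurable_fun [set: measurableTypeR R] f ->
  (\int[mu]_(x in D) (f x)%:E = \int[leb]_(x in D) (f x * w x)%:E)%E.
Proof.
move=> mD intw muw f0 mf.
have muD : (mu D < +oo)%E by rewrite ltey_eq fin_num_measure.
pose nu : {finite_measure set (measurableTypeR R) -> \bar R} := mfrestr mD muD.
have nu_leb : nu `<< leb.
  apply/null_content_dominatesP => A mA A0.
  rewrite /nu /= /mfrestr /mrestr /= muw; [|exact: measurableI|exact: subIsetr].
  apply: null_set_integral; first exact: measurableI.
    apply: (measurable_funS mD); first exact: subIsetr.
    exact: measurable_int intw.
  apply/eqP; rewrite -measure_le0 -A0; apply: le_measure; rewrite ?inE//.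
  exact: measurableI.
have nuE (A : set (measurableTypeR R)) : measurable A -> A `<=` D -> nu A = mu A.
  by move=> mA AD; rewrite /nu /= /mfrestr /mrestr setIidl.
transitivity (\int[nu]_(x in D) (f x)%:E)%E.
  by apply: eq_measure_integral => A mA AD; exact/esym/nuE.
rewrite -(Radon_Nikodym_SigmaFinite.change_of_variables nu_leb)//=; last first.
  by apply/measurable_EFinP; exact: measurable_funTS.
have int_g := Radon_Nikodym_SigmaFinite.f_integrable nu_leb.
under [RHS]eq_integral do rewrite EFinM.
apply: ae_eq_integral => //.
- apply: emeasurable_funM; first by apply/measurable_EFinP; exact: measurable_funTS.
  by apply: measurable_funTS; exact: measurable_int int_g.
- apply: emeasurable_funM; first by apply/measurable_EFinP; exact: measurable_funTS.
  exact: measurable_int intw.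
- apply: ae_eqe_mul2l; apply: integral_ae_eq => //=.
  + exact: integrableS int_g.
  + exact: measurable_int intw.
  + move=> E ED mE; rewrite -Radon_Nikodym_SigmaFinite.f_integral// nuE//.
    exact: muw.
Qed.
End density.

Section functionals.
Context {R : realType}.
Local Notation leb := (@lebesgue_measure R).
Implicit Types (P Q : {poly R}) (mu : {finite_measure set (measurableTypeR R) -> \bar R}).

Lemma measurable_horner P (D : set (measurableTypeR R)) : measurable_fun D (horner P).
Proof.
by apply: measurable_funTS; apply: continuous_measurable_fun; exact: continuous_horner.
Qed.

Lemma horner_bounded P : exists2 M : R, 0 <= M & forall x, -1 <= x <= 1 -> `|P.[x]| <= M.
Proof.
exists (\sum_(i < size P) `|P`_i|); first exact: sumr_ge0.
move=> x x1; rewrite horner_coef (le_trans (ler_norm_sum _ _ _))//.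
apply: ler_sum => i _; rewrite normrM normrX ler_piMr// exprn_ile1//.
by rewrite ler_norml.
Qed.

Lemma integrable_horner mu P : mu.-integrable `]-1, 1[ (EFin \o horner P).
Proof.
apply: measurable_bounded_integrable.
- exact: measurable_itv.
- by rewrite ltey_eq fin_num_measure.
- exact: measurable_horner.
have [M M0 PM] := horner_bounded P.
exists M; split; first by rewrite num_real.
move=> N MN x /=; rewrite in_itv/= => /andP[x0 x1].
by rewrite (le_trans (PM x _)) ?ltW ?x0.
Qed.

Definition mu_int mu P : R := \int[mu]_(x in `]-1, 1[) P.[x].

Lemma mu_int_is_scalar mu : scalar (mu_int mu).
Proof.
move=> a P Q; rewrite /mu_int.
have e x : (a *: P + Q).[x] = a * P.[x] + Q.[x] by rewrite !hornerE.
under eq_Rintegral do rewrite e.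
have iP : mu.-integrable `]-1, 1[ (EFin \o (fun x => a * P.[x])).
  have := integrable_horner mu (a *: P); congr (integrable _ _ _).
  by apply/funext => x /=; rewrite hornerZ.
rewrite RintegralD//; last exact: integrable_horner.
by rewrite RintegralZl//; exact: integrable_horner.
Qed.

HB.instance Definition _ mu := GRing.isLinear.Build R {poly R} R *%R (mu_int mu)
  (mu_int_is_scalar mu).

Lemma mu_int_ge0 mu P : (forall x, -1 < x < 1 -> 0 <= P.[x]) -> 0 <= mu_int mu P.
Proof. by move=> P0; apply: Rintegral_ge0 => x /=; rewrite in_itv/= => /P0. Qed.

Lemma continuous_horner_cos P : continuous (fun t : R => P.[cos t]).
Proof.
move=> t; apply: (@continuous_comp _ _ _ (@cos R) (horner P)).
  exact: continuous_cos.
exact: continuous_horner.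
Qed.

Lemma integrable_horner_cos P (a b : R) :
  leb.-integrable `[a, b] (EFin \o (fun t => P.[cos t])).
Proof.
apply: continuous_compact_integrable; first exact: segment_compact.
by apply: continuous_subspaceT; exact: continuous_horner_cos.
Qed.

(** The integral against [dx / (pi sqrt (1 - x ^ 2))], written in the variable [t = acos x] to
    remove the endpoint singularities. *)
Definition cheb_int P : R := pi^-1 * \int[leb]_(t in `[0, pi]) P.[cos t].

Lemma cheb_int_is_scalar : scalar cheb_int.
Proof.
move=> a P Q; rewrite /cheb_int.
have e x : (a *: P + Q).[cos x] = a * P.[cos x] + Q.[cos x] by rewrite !hornerE.
under eq_Rintegral do rewrite e.
have iP : leb.-integrable `[0, pi] (EFin \o (fun t => a * P.[cos t])).
  have := integrable_horner_cos (a *: P) 0 pi; congr (integrable _ _ _).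
  by apply/funext => x /=; rewrite hornerZ.
rewrite RintegralD//; last exact: integrable_horner_cos.
rewrite RintegralZl//; last exact: integrable_horner_cos.
by rewrite /=; ring.
Qed.

HB.instance Definition _ := GRing.isLinear.Build R {poly R} R *%R cheb_int cheb_int_is_scalar.

Lemma integral_cos_mul (m : nat) :
  \int[leb]_(t in `[0, pi]) cos (m%:R * t) = (m == 0%N)%:R * pi.
Proof.
case: m => [|m] /=.
  under eq_Rintegral do rewrite mul0r cos0.
  rewrite Rintegral_cst ?mul1r; last exact: measurable_itv.
  have := lebesgue_measure_itv `[0, pi : R]; rewrite /= lte_fin pi_gt0 sube0.
  by move=> /(congr1 fine) /= e; rewrite -[RHS]e.
rewrite mul0r /Rintegral.
set c : R := m.+1%:R.
have c0 : c != 0 by rewrite pnatr_eq0.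
pose F : R -> R := c^-1 *: (sin \o (c *: (@id R))).
have dF (t : R) : is_derive t (1 : R) F (cos (c * t)).
  by apply: is_derive_eq; rewrite /GRing.scale/= mulr1 mulrCA mulVf ?mulr1.
have cF : continuous F.
  move=> t; apply: differentiable_continuous; apply/derivable1_diffP.
  exact: (@ex_derive _ _ _ _ _ _ _ (dF t)).
have cc : continuous (fun t : R => cos (c * t)).
  move=> t; apply: (@continuous_comp _ _ _ ( *%R c) (@cos R)).
    exact: mulrl_continuous.
  exact: continuous_cos.
rewrite (@continuous_FTC2 _ _ F)//=.
- have FE t : F t = c^-1 * sin (c * t) by [].
  rewrite !FE mulr0 sin0 mulr0 subr0.
  (* The value [sin (c * pi)] vanishes as a value of [chebV] times [sin pi]. *)
  by rewrite /c -(cheb_cos m.+1 pi).2 sinpi !mulr0.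
- exact: pi_gt0.
- exact: continuous_subspaceT.
- split.
  + by move=> t _; exact: (@ex_derive _ _ _ _ _ _ _ (dF t)).
  + by apply: cvg_at_right_filter; exact: cF.
  + by apply: cvg_at_left_filter; exact: cF.
- by move=> t _; rewrite derive1E (@derive_val _ _ _ _ _ _ _ (dF t)).
Qed.

Lemma size_chebN k : size (chebN k : {poly R}) = k.+1.
Proof.
have nz : (if k == 0%N then 1 else Num.sqrt 2 : R) != 0.
  by case: ifP => _; rewrite ?oner_eq0// sqrtr_eq0 -ltNge.
by rewrite size_scale// size_chebT.
Qed.

Lemma cheb_int_mul m n :
  cheb_int (chebT m * chebT n) = ((m == n)%:R + (m + n == 0)%N%:R) / 2.
Proof.
wlog mn : m n / (m <= n)%N => [th|].
  by have [/th//|/ltnW/th e] := leqP m n; rewrite mulrC e eq_sym addnC.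
have e (t : R) : (chebT m * chebT n).[cos t] =
    2^-1 * (cos ((n - m)%:R * t) + cos ((m + n)%:R * t)).
  rewrite hornerM !(cheb_cos _ _).1 natrB// natrD mulrBl mulrDl cosB cosD.
  by field.
rewrite /cheb_int; under eq_Rintegral do rewrite e.
have ic k : leb.-integrable `[0, pi] (EFin \o (fun t : R => cos (k%:R * t))).
  have := integrable_horner_cos (chebT k) 0 pi; congr (integrable _ _ _).
  by apply/funext => t /=; rewrite (cheb_cos _ _).1.
have iD : leb.-integrable `[0, pi]
    (EFin \o (fun t : R => cos ((n - m)%:R * t) + cos ((m + n)%:R * t))).
  have := integrable_horner_cos (chebT (n - m) + chebT (m + n)) 0 pi.
  congr (integrable _ _ _); apply/funext => t /=.
  by rewrite hornerD !(cheb_cos _ _).1.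
rewrite RintegralZl// RintegralD//.
rewrite !integral_cos_mul subn_eq0 -mulrDl.
have -> : (n <= m)%N = (m == n) by rewrite eqn_leq mn.
have := pi_gt0 R; move: (pi) => x x0; field; exact: lt0r_neq0.
Qed.

Lemma chebN_orthonormal m n : cheb_int (chebN m * chebN n) = (m == n)%:R.
Proof.
rewrite /chebN -scalerAl -scalerAr scalerA linearZ /= cheb_int_mul.
have [<-|mn] := eqVneq m n.
  rewrite addnn double_eq0; case: eqP => _ /=.
    by rewrite mulr1 mul1r; field.
  by rewrite -expr2 sqr_sqrtr// addr0; field.
have -> : (m + n == 0)%N = false by case: m n mn => [|m] [|n].
by rewrite addr0 mul0r mulr0.
Qed.

End functionals.

Section arcsine_substitution.
Context {R : realType}.
Local Notation leb := (@lebesgue_measure R).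

Lemma arcsine_weight_continuous (P : {poly R}) (al be : R) : -1 < al -> be < 1 ->
  {within `[al, be], continuous (fun x => P.[x] / Num.sqrt (1 - 'X ^+ 2).[x])}.
Proof.
move=> al1 be1.
apply: continuous_in_subspaceT => x; rewrite inE/= in_itv/= => /andP[x1 x2].
apply: continuousM; first exact: continuous_horner.
apply: continuousV.
  rewrite sqrtr_eq0 -ltNge !hornerE subr_gt0.
  by have := lt_le_trans al1 x1; have := le_lt_trans x2 be1; nra.
apply: (@continuous_comp _ _ _ (fun y : R => (1 - 'X ^+ 2).[y]) (@Num.sqrt R) x) => /=.
  exact: continuous_horner.
exact: sqrt_continuous.
Qed.

Lemma arcsine_substitution (P : {poly R}) (al be : R) : -1 < al -> al <= be -> be < 1 ->
  (\int[leb]_(x in `[al, be]) (P.[x] / Num.sqrt (1 - 'X ^+ 2).[x])%:E =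
   \int[leb]_(t in `[acos be, acos al]) (P.[cos t])%:E)%E.
Proof.
move=> al1 albe be1.
have al_in : -1 <= al <= 1 by rewrite ltW//= ltW// (le_lt_trans albe).
have be_in : -1 <= be <= 1 by rewrite !ltW// (lt_le_trans al1).
have acos_in (x : R) : -1 <= x <= 1 -> acos x \in `[0, pi].
  by move=> x1; rewrite in_itv/= acos_ge0// acos_lepi.
have le_acos : acos be <= acos al.
  rewrite leNgt; apply/negP => h.
  have := ltr_cos (acos_in _ al_in) (acos_in _ be_in).
  by rewrite h !cos_acosK// ltNge albe.
have sub (t : R) : t \in `[acos be, acos al] -> t \in `]0, pi[.
  rewrite !in_itv/= => /andP[t1 t2]; apply/andP; split.
    by rewrite (lt_le_trans _ t1)// acos_gt0// be1 andbT; case/andP: be_in.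
  by rewrite (le_lt_trans t2)// acos_ltpi// al1/=; case/andP: al_in.
have oocc (t : R) : t \in `]0, pi[ -> t \in `[0, pi].
  by rewrite !in_itv/= => /andP[/ltW-> /ltW->].
have cosE : ((@cos R)^`())%classic = (fun x => - sin x).
  by apply/funext => x; rewrite derive1E (@derive_val _ _ _ _ _ _ _ (is_derive_cos x)).
have csin : continuous (fun x : R => - sin x).
  by move=> x; apply: continuousN; exact: continuous_sin.
have := @integration_by_substitution_decreasing R cos
  (fun x => P.[x] / Num.sqrt (1 - 'X ^+ 2).[x]) _ _ le_acos.
rewrite !cos_acosK// cosE => -> //.
- apply: eq_integral => t; rewrite inE/= => /sub t0; congr (_%:E).
  have st : 0 < sin t by apply: sin_gt0_pi; move: t0; rewrite in_itv.
  rewrite /GRing.mul/= /GRing.opp/= opprK.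
  by rewrite !hornerE -sin2cos2 sqrtr_sqr gtr0_norm// mulfVK// lt0r_neq0.
- move=> x y /sub x0 /sub y0 xy; rewrite ltr_cos//.
    exact: oocc.
  exact: oocc.
- by apply: (cvgP (- sin (acos be))); apply: cvg_at_right_filter; exact: csin.
- by apply: (cvgP (- sin (acos al))); apply: cvg_at_left_filter; exact: csin.
- split.
  + by move=> x _; exact: derivable_cos.
  + by apply: cvg_at_right_filter; exact: continuous_cos.
  + by apply: cvg_at_left_filter; exact: continuous_cos.
exact: arcsine_weight_continuous.
Qed.

End arcsine_substitution.

Lemma cheb_intE {R : realType} (P : {poly R}) :
  ((pi * cheb_int P)%R%:E =
   \int[@lebesgue_measure R]_(t in `[0%R, pi]) (P.[cos t])%:E)%E.
Proof.
rewrite /cheb_int mulrA mulfV ?lt0r_neq0 ?pi_gt0// mul1r /Rintegral fineK//.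
by apply: integrable_fin_num => //; exact: integrable_horner_cos.
Qed.

Lemma measurable_horner_cos {R : realType} (P : {poly R}) (A : set (measurableTypeR R)) :
  measurable_fun A (fun t => (P.[cos t])%:E : \bar R).
Proof.
apply/measurable_EFinP; apply: measurable_funTS; apply: continuous_measurable_fun.
exact: continuous_horner_cos.
Qed.

Lemma cheb_intC {R : realType} (c : R) : cheb_int c%:P = c.
Proof.
have := @chebN_orthonormal R 0 0; rewrite /chebN/= !scale1r mulr1 => h.
by rewrite -[c%:P]mulr1 mul_polyC linearZ /= h mulr1.
Qed.

(** * Comparison of the two integrals of a polynomial that is small off an interval *)

Section local_comparison.
Context {R : realType} (mu : {finite_measure set (measurableTypeR R) -> \bar R}).
Local Notation leb := (@lebesgue_measure R).
Variables (w : R -> R) (al be lo hi ka : R) (P : {poly R}).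
Hypotheses (al1 : -1 < al) (albe : al <= be) (be1 : be < 1) (lo0 : 0 <= lo).
Hypothesis int_w : leb.-integrable `[al, be] (EFin \o w).
Hypothesis mu_w : forall A : set (measurableTypeR R), measurable A ->
  A `<=` `[al, be] -> mu A = (\int[leb]_(x in A) (w x)%:E)%E.
Hypothesis w_bound : forall x, al <= x <= be ->
  lo <= w x * (pi * Num.sqrt (1 - x ^+ 2)) <= hi.
Hypothesis P_ge0 : forall x, 0 <= P.[x].
Hypothesis P_le : forall x, -1 <= x <= 1 -> ~~ (al <= x <= be) -> P.[x] <= ka.
Hypothesis ka0 : 0 <= ka.

Let J : set (measurableTypeR R) := `[al, be].
Let D : set (measurableTypeR R) := `]-1, 1[.
Let q (x : R) := P.[x] / Num.sqrt (1 - 'X ^+ 2).[x].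

Let mJ : measurable J. Proof. exact: measurable_itv. Qed.
Let mD : measurable D. Proof. exact: measurable_itv. Qed.

Let JD : J `<=` D.
Proof.
move=> x; rewrite /J /D /= !in_itv/= => /andP[x1 x2].
by rewrite (lt_le_trans al1)// (le_lt_trans x2).
Qed.

Let sqrt_gt0 x : al <= x <= be -> 0 < Num.sqrt (1 - x ^+ 2).
Proof.
move=> /andP[x1 x2]; rewrite sqrtr_gt0.
by have := lt_le_trans al1 x1; have := le_lt_trans x2 be1; nra.
Qed.

Let measurable_P (A : set (measurableTypeR R)) :
  measurable_fun A (fun x => (P.[x])%:E : \bar R).
Proof. by apply/measurable_EFinP; exact: measurable_horner. Qed.

Let mu_P : ((mu_int mu P)%:E = \int[mu]_(x in D) (P.[x])%:E)%E.
Proof. by rewrite /mu_int /Rintegral fineK//; apply: integrable_fin_num => //; exact: integrable_horner. Qed.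

Let mu_J : (\int[mu]_(x in J) (P.[x])%:E = \int[leb]_(x in J) (P.[x] * w x)%:E)%E.
Proof. by apply: integral_density => //; exact: measurable_horner. Qed.

Let q_ge0 x : 0 <= q x.
Proof. by rewrite divr_ge0// sqrtr_ge0. Qed.

Let w_ge0 x : J x -> 0 <= w x.
Proof.
rewrite /J /= in_itv/= => xJ; have /andP[h _] := w_bound x xJ.
rewrite -(pmulr_lge0 _ (mulr_gt0 (pi_gt0 R) (sqrt_gt0 x xJ))).
exact: le_trans h.
Qed.

Let q_w x : J x -> lo / pi * q x <= P.[x] * w x <= hi / pi * q x.
Proof.
rewrite /J /= in_itv/= => xJ; have /andP[h1 h2] := w_bound x xJ.
have s0 := sqrt_gt0 x xJ; have p0 := pi_gt0 R.
have -> : P.[x] * w x = (w x * (pi * Num.sqrt (1 - x ^+ 2))) / pi * q x.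
  rewrite (_ : q x = P.[x] / Num.sqrt (1 - x ^+ 2)); last by rewrite /q !hornerE.
  move: (pi) (Num.sqrt _) p0 s0 => y s y0 s0; field.
  by rewrite !lt0r_neq0.
have pV : 0 <= pi^-1 :> R by rewrite invr_ge0 ltW.
by apply/andP; split; do 2 apply: ler_wpM2r => //.
Qed.

Let Th : set (measurableTypeR R) := `[acos be, acos al].

Let al_in : -1 <= al <= 1. Proof. by rewrite ltW//= ltW// (le_lt_trans albe). Qed.
Let be_in : -1 <= be <= 1. Proof. by rewrite !ltW// (lt_le_trans al1). Qed.

Let Th_sub : Th `<=` `[0, pi].
Proof.
move=> t; rewrite /Th /= !in_itv/= => /andP[t1 t2].
by rewrite (le_trans _ t1) ?acos_ge0// (le_trans t2)// acos_lepi.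
Qed.

Let Th_cos t : 0 <= t <= pi -> ~ Th t -> ~~ (al <= cos t <= be).
Proof.
move=> t0 nT; apply/negP => /andP[c1 c2]; apply: nT.
have cI (x : R) : -1 <= x <= 1 -> acos x \in `[0, pi].
  by move=> x1; rewrite in_itv/= acos_ge0// acos_lepi.
have tI : t \in `[0, pi] by rewrite in_itv.
rewrite /Th /= in_itv/=; apply/andP; split.
  rewrite leNgt -(ltr_cos tI (cI _ be_in)) cos_acosK// -leNgt //.
by rewrite leNgt -(ltr_cos (cI _ al_in) tI) cos_acosK// -leNgt.
Qed.

Let mTh : measurable Th. Proof. exact: measurable_itv. Qed.

Let measurable_q : measurable_fun J (fun x => (q x)%:E : \bar R).
Proof.
apply/measurable_EFinP; apply: subspace_continuous_measurable_fun => //.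
exact: arcsine_weight_continuous.
Qed.

Let q_Th : (\int[leb]_(x in J) (q x)%:E = \int[leb]_(t in Th) (P.[cos t])%:E)%E.
Proof. exact: arcsine_substitution. Qed.

(** On the interval, [w] is at most [hi] times the arcsine density, and extending that integral to
    the full range only adds nonnegative values; off it, [P] is at most [ka] and [mu] has finite
    mass. *)
Lemma mu_int_le : mu_int mu P <= hi * cheb_int P + ka * mu_int mu 1.
Proof.
have hi0 : 0 <= hi.
  have /andP[h1 h2] : lo <= w al * (pi * Num.sqrt (1 - al ^+ 2)) <= hi.
    by apply: w_bound; rewrite lexx.
  by rewrite (le_trans lo0)// (le_trans h1).
have hipi : 0 <= hi / pi by rewrite divr_ge0// pi_ge0.
have -> : ka * mu_int mu 1 = mu_int mu ka%:P by rewrite -[ka%:P]mulr1 mul_polyC linearZ.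
rewrite -lee_fin mu_P -(setDUK JD) ge0_integral_setU//; last 3 first.
- exact: measurableD.
- by move=> x _; rewrite lee_fin.
- by rewrite disj_set2E setDIK.
rewrite EFinD; apply: leeD.
  rewrite mu_J; apply: (@le_trans _ _ (\int[leb]_(x in J) ((hi / pi)%:E * (q x)%:E))%E).
    apply: ge0_le_integral => //=.
    - by move=> x xJ; rewrite lee_fin mulr_ge0// w_ge0.
    - apply/measurable_EFinP; apply: measurable_funM; first exact: measurable_horner.
      by apply/measurable_EFinP; exact: measurable_int int_w.
    - by apply: measurable_funeM; exact: measurable_q.
    - by move=> x xJ; rewrite -EFinM lee_fin; case/andP: (q_w x xJ).
  rewrite ge0_integralZl_EFin//; last by move=> x _; rewrite lee_fin.
  rewrite q_Th (_ : hi * cheb_int P = hi / pi * (pi * cheb_int P)); last first.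
    by rewrite mulrA mulfVK// lt0r_neq0// pi_gt0.
  rewrite (EFinM (hi / pi)) cheb_intE lee_wpmul2l ?lee_fin//.
  apply: ge0_subset_integral => //; first exact: measurable_horner_cos.
  by move=> x _; rewrite lee_fin.
rewrite /mu_int /Rintegral fineK; last first.
  by apply: integrable_fin_num => //; exact: integrable_horner.
apply: (@le_trans _ _ (\int[mu]_(x in D `\` J) (ka%:P.[x])%:E)%E).
  apply: ge0_le_integral => //=.
  - exact: measurableD.
  - by move=> x _; rewrite lee_fin.
  - by apply/measurable_EFinP; exact: measurable_horner.
  - move=> x [xD xJ]; rewrite lee_fin hornerC; apply: P_le.
      by move: xD; rewrite /D /= in_itv/= => /andP[/ltW-> /ltW->].
    by apply/negP => xJ'; apply: xJ; rewrite /J /= in_itv.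
apply: ge0_subset_integral => //; first exact: measurableD.
- by apply/measurable_EFinP; exact: measurable_horner.
- by move=> x _; rewrite lee_fin hornerC.
Qed.

(** The same splitting with the roles exchanged: [w] is at least [lo] times the arcsine density on
    the interval, and the rest has arcsine mass at most 1. *)
Lemma cheb_int_le : lo * cheb_int P <= mu_int mu P + lo * ka.
Proof.
have lopi : 0 <= lo / pi by rewrite divr_ge0// pi_ge0.
have scale y : lo * y = lo / pi * (pi * y).
  by rewrite mulrA mulfVK// lt0r_neq0// pi_gt0.
rewrite -lee_fin EFinD (scale ka) (scale (cheb_int P)) !(EFinM (lo / pi)) cheb_intE.
rewrite -{1}(setDUK Th_sub).
have mC : measurable (`[0%R, pi] `\` Th : set (measurableTypeR R)).
  by apply: measurableD => //; exact: measurable_itv.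
rewrite ge0_integral_setU//; last 3 first.
- exact: measurable_horner_cos.
- by move=> x _; rewrite lee_fin.
- by rewrite disj_set2E setDIK.
rewrite ge0_muleDr; last 2 first.
- by apply: integral_ge0 => x _; rewrite lee_fin.
- by apply: integral_ge0 => x _; rewrite lee_fin.
apply: leeD.
  rewrite -q_Th -ge0_integralZl_EFin//; last by move=> x _; rewrite lee_fin.
  rewrite mu_P; apply: (@le_trans _ _ (\int[mu]_(x in J) (P.[x])%:E)%E).
    rewrite mu_J; apply: ge0_le_integral => //=.
    - by move=> x _; rewrite -EFinM lee_fin mulr_ge0.
    - by apply: measurable_funeM; exact: measurable_q.
    - apply/measurable_EFinP; apply: measurable_funM; first exact: measurable_horner.
      by apply/measurable_EFinP; exact: measurable_int int_w.
    - by move=> x xJ; rewrite -EFinM lee_fin; case/andP: (q_w x xJ).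
  apply: ge0_subset_integral => //.
  by move=> x _; rewrite lee_fin.
rewrite lee_wpmul2l ?lee_fin//.
rewrite -[ka in leRHS](cheb_intC ka) cheb_intE.
apply: (@le_trans _ _ (\int[leb]_(t in `[0%R, pi] `\` Th) (ka%:P.[cos t])%:E)%E).
  apply: ge0_le_integral => //=.
  - by move=> x _; rewrite lee_fin.
  - exact: measurable_horner_cos.
  - exact: measurable_horner_cos.
  - move=> x [xD xJ]; rewrite lee_fin hornerC; apply: P_le.
      by rewrite cos_geN1 cos_le1.
    by apply: Th_cos => //; move: xD; rewrite /= in_itv.
apply: ge0_subset_integral => //.
- exact: measurable_horner_cos.
- by move=> x _; rewrite lee_fin hornerC.
Qed.

End local_comparison.

(** * Peak polynomials and the comparison of extremal values *)

Section peak_polynomial.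
Context {R : realType}.
Implicit Types (P W : {poly R}) (x t de : R).

Lemma derivn_XsubC_root P x L j : (j < L)%N -> ((('X - x%:P) ^+ L * P)^`(j)).[x] = 0.
Proof.
elim: j L P => [|j IHj] [//|L] P jL.
  by rewrite derivn0 hornerM horner_exp hornerXsubC subrr expr0n mul0r.
rewrite derivSn (_ : (_ * _)^`() = ('X - x%:P) ^+ L * (P *+ L.+1 + ('X - x%:P) * P^`())).
  by rewrite IHj.
by rewrite derivM deriv_exp derivXsubC mul1r exprS mulrnAl /= -mulr_natl -[P *+ _]mulr_natl; ring.
Qed.

(* Equal to 1 up to order [L] at [x], and geometrically small in [k] away from [x]
   (for [L] even). *)
Definition peak x L k : {poly R} := (1 - (2^-1 *: ('X - x%:P)) ^+ L) ^+ k.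

Lemma size_peak x L k : (size (peak x L k) <= (L * k).+1)%N.
Proof.
rewrite (leq_trans (size_poly_exp_leq _ _))// ltnS leq_mul2r; apply/orP; right.
have s1 : (size (2^-1 *: ('X - x%:P)) <= 2)%N.
  by rewrite (leq_trans (size_scale_leq _ _))// size_XsubC.
have sL : (size ((2^-1 *: ('X - x%:P)) ^+ L) <= L.+1)%N.
  rewrite (leq_trans (size_poly_exp_leq _ _))// ltnS -[leqRHS]mul1n leq_mul2r.
  by rewrite -ltnS (leq_trans (leqSpred _) _) ?orbT//; case: size s1 => [|[|[]]].
rewrite -ltnS (@leq_trans L.+1)//.
have : (size (1 - (2^-1 *: ('X - x%:P)) ^+ L : {poly R})%R <= L.+1)%N.
  by rewrite (leq_trans (size_polyD _ _))// size_polyN geq_max sL size_poly1.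
by case: size.
Qed.

Lemma peakE x L k t : (peak x L k).[t] = (1 - ((t - x) / 2) ^+ L) ^+ k.
Proof.
by rewrite horner_exp hornerD hornerN hornerC horner_exp hornerZ hornerXsubC mulrC.
Qed.

(** The difference [peak x L k - 1] is divisible by [('X - x) ^ L], so the product differs from [P]
    by a term vanishing to order [L] at [x]. *)
Lemma derivn_mul_peak P x L k j : (j < L)%N ->
  ((P * peak x L k)^`(j)).[x] = (P^`(j)).[x].
Proof.
move=> jL; rewrite -[X in P * X](subrK 1) mulrDr mulr1 derivnD hornerD.
have -> : peak x L k - 1 = ('X - x%:P) ^+ L *
    (- (2^-1 ^+ L) *: \sum_(i < k) (1 - (2^-1 *: ('X - x%:P)) ^+ L) ^+ (k.-1 - i)).
  rewrite /peak -[X in _ - X](expr1n _ k) subrXX.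
  under eq_bigr do rewrite expr1n mulr1.
  rewrite addrAC subrr add0r exprZn -scalerAr scaleNr mulNr -scalerAl.
  by rewrite mulrC.
by rewrite mulrCA derivn_XsubC_root// add0r.
Qed.

(** The factor 1/2 in [peak] keeps [(t - x) / 2] in [[-1, 1]], and the even exponent makes its power
    nonnegative. *)
Lemma peak_ge0_le1 x l k t : `|x| <= 1 -> `|t| <= 1 ->
  0 <= (peak x l.*2 k).[t] <= 1.
Proof.
rewrite !ler_norml => /andP[x0 x1] /andP[t0 t1]; rewrite peakE.
rewrite -muln2 mulnC exprM; set y := (_ / 2) ^+ 2.
have y0 : 0 <= y by exact: sqr_ge0.
have y1 : y <= 1 by rewrite /y; nra.
have := exprn_ge0 l y0; have := exprn_ile1 l y0 y1.
set z := y ^+ l => z1 z0.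
by rewrite exprn_ge0 ?exprn_ile1//; lra.
Qed.

Lemma peak_le x l k t de : 0 < de -> de <= 1 -> `|x| <= 1 -> `|t| <= 1 ->
  de <= `|t - x| -> (peak x l.*2 k).[t] <= (1 - (de / 2) ^+ l.*2) ^+ k.
Proof.
move=> de0 de1 x1 t1 tx; rewrite peakE.
have h : (de / 2) ^+ l.*2 <= ((t - x) / 2) ^+ l.*2.
  rewrite -[leRHS]ger0_norm; last by rewrite exprn_even_ge0// odd_double.
  rewrite normrX lerXn2r ?nnegrE ?normr_ge0//; first by rewrite divr_ge0// ltW.
  by rewrite normrM [`|2^-1|]ger0_norm// ler_pM2r.
have := peak_ge0_le1 x l 1 t x1 t1; rewrite peakE expr1 => /andP[p0 p1].
by rewrite lerXn2r ?nnegrE//; lra.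
Qed.

End peak_polynomial.

(** * Transfer of extremal values between two inner products *)

Section transfer.
Context {R : realType} (I1 I2 : {scalar {poly R}}) (p1 p2 : nat -> {poly R}).
Hypothesis size_p1 : forall n, size (p1 n) = n.+1.
Hypothesis size_p2 : forall n, size (p2 n) = n.+1.
Hypothesis orth1 : forall m n, I1 (p1 m * p1 n) = (m == n)%:R.
Hypothesis orth2 : forall m n, I2 (p2 m * p2 n) = (m == n)%:R.

(** With [Q] the extremal polynomial of the first inner product, [Q * S] is a competitor for the
    second with the same value of [l]. If [X] is the first extremal value, this reads [X ^ 2 <= a *
    X * christoffel p2 l (n + m)], and [X] cancels unless it is 0. *)
Lemma christoffel_transfer (l : {scalar {poly R}}) (S : {poly R}) n m (a : R) :
  0 <= a -> (size S <= m.+1)%N -> (forall Q : {poly R}, l (Q * S) = l Q) ->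
  (forall Q : {poly R}, (size Q <= n)%N -> I2 ((Q * S) ^+ 2) <= a * I1 (Q ^+ 2)) ->
  christoffel p1 l n <= a * christoffel p2 l (n + m).
Proof.
move=> a0 sS lS h; set Q := kernel_poly p1 l n.
have sQ : (size Q <= n)%N by exact: size_kernel_poly.
have sQS : (size (Q * S)%R <= n + m)%N.
  have [->|Q0] := eqVneq Q 0; first by rewrite mul0r size_poly0.
  rewrite (leq_trans (size_polyMleq _ _))//.
  by rewrite -subn1 leq_subLR add1n -addnS leq_add.
have := christoffel_upper I2 p2 size_p2 orth2 l (n + m) (Q * S) sQS.
rewrite lS kernel_polyE => /le_trans /(_ (ler_wpM2l (christoffel_ge0 p2 l (n + m)) (h Q sQ))).
rewrite (norm_kernel_poly I1 p1 orth1).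
have := christoffel_ge0 p1 l n; rewrite le_eqVlt => /predU1P[<- _|L0].
  by rewrite mulr_ge0// christoffel_ge0.
by rewrite mulrA expr2 ler_pM2r// mulrC.
Qed.

End transfer.

Section derivative_functional.
Context {R : realType}.
Implicit Types (p : nat -> {poly R}) (x sg : R).

(* The functionals whose extremal values give the kernels [K^(r,s)] by polarization. *)
Definition deriv_pair sg x (N r s : nat) (P : {poly R}) : R :=
  (P^`(r)).[x] / N%:R ^+ r + sg * ((P^`(s)).[x] / N%:R ^+ s).

Lemma deriv_pair_is_scalar sg x N r s : scalar (deriv_pair sg x N r s).
Proof.
by move=> a P Q; rewrite /deriv_pair !derivnD !derivnZ !hornerD !hornerZ /=; ring.
Qed.

HB.instance Definition _ sg x N r s := GRing.isLinear.Build R {poly R} R *%R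
  (deriv_pair sg x N r s) (deriv_pair_is_scalar sg x N r s).

Lemma deriv_pair_peak sg x N r s l k P : (r < l.*2)%N -> (s < l.*2)%N ->
  deriv_pair sg x N r s (P * peak x l.*2 k) = deriv_pair sg x N r s P.
Proof. by move=> rl sl; rewrite /deriv_pair !derivn_mul_peak. Qed.

Lemma polarization p x (N r s n : nat) :
  christoffel p (deriv_pair 1 x N r s) n - christoffel p (deriv_pair (-1) x N r s) n =
  4 * (cd_kernel_diag p r s n x / N%:R ^+ (r + s)).
Proof.
rewrite /christoffel /cd_kernel_diag -sumrB mulr_suml mulr_sumr.
by apply: eq_bigr => k _; rewrite /deriv_pair exprD invfM; ring.
Qed.

(** The powers of [N] compensate the growth [k ^ j] of the derivatives of order [j]. Degrees up to
    [2 N] are allowed because a peak factor raises the degree beyond [N]. *)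
Lemma deriv_pair_chebN_le (r s : nat) (s0 : R) : 0 < s0 -> exists2 B : R, 0 <= B &
  forall k N sg x, (0 < N)%N -> (k <= N.*2)%N -> `|sg| <= 1 -> -1 <= x <= 1 ->
    s0 <= Num.sqrt (1 - x ^+ 2) -> `|deriv_pair sg x N r s (chebN k)| <= B.
Proof.
move=> s0_gt0.
have one j : exists2 B : R, 0 <= B & forall k N x, (0 < N)%N -> (k <= N.*2)%N ->
    -1 <= x <= 1 -> s0 <= Num.sqrt (1 - x ^+ 2) ->
    `|((chebN k)^`(j)).[x] / N%:R ^+ j| <= B.
  have [B B0 hB] := chebT_deriv_le j s0 s0_gt0.
  exists (Num.sqrt 2 * (B * 2 ^+ j / s0 ^+ j)).
    by rewrite mulr_ge0 ?sqrtr_ge0// divr_ge0 ?mulr_ge0 ?exprn_ge0// ltW.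
  move=> k N x N0 kN x1 sx.
  have NR : 0 < N%:R :> R by rewrite ltr0n.
  rewrite /chebN derivnZ hornerZ -mulrA normrM; apply: ler_pM => //.
    case: ifP => _; rewrite ger0_norm ?sqrtr_ge0//.
    by rewrite -[X in X <= _]sqrtr1 ler_wsqrtr// ler1n.
  rewrite -{1}(cos_acosK x x1) normrM normfV ler_pdivrMr ?normr_gt0 ?expf_neq0 ?lt0r_neq0//.
  rewrite [`|N%:R ^+ j|]ger0_norm ?exprn_ge0//.
  rewrite -(ler_pM2r (exprn_gt0 j s0_gt0)) mulrAC mulfVK ?expf_neq0 ?lt0r_neq0//.
  have st : s0 <= sin (acos x) by rewrite sin_acos.
  have := hB k (acos x) st; rewrite normrM => h.
  apply: (@le_trans _ _ (B * k%:R ^+ j)).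
    have s_gt0 : 0 < sin (acos x) by exact: lt_le_trans st.
    rewrite (le_trans _ h)// ler_wpM2l// ger0_norm ?exprn_ge0 ?(ltW s_gt0)//.
    by rewrite lerXn2r ?nnegrE ?(ltW s0_gt0) ?(ltW s_gt0).
  rewrite -mulrA -exprMn ler_wpM2l// lerXn2r ?nnegrE//.
  by rewrite -natrM ler_nat mul2n.
have [Br Br0 hr] := one r; have [Bs Bs0 hs] := one s.
exists (Br + Bs); first by rewrite addr_ge0.
move=> k N sg x N0 kN sg1 x1 sx; rewrite (le_trans (ler_normD _ _))// lerD ?hr//.
by rewrite normrM (le_trans (ler_piMl _ sg1)) ?hs.
Qed.

(** Each additional basis element contributes a bounded square, so a small relative change of degree
    changes the extremal value, divided by [N], only slightly. *)
Lemma christoffel_cheb_le (r s : nat) (s0 : R) : 0 < s0 -> exists2 B : R, 0 < B &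
  forall M1 M2 N sg x, (0 < N)%N -> (M1 <= M2)%N -> (M2 <= N.*2)%N -> `|sg| <= 1 ->
    -1 <= x <= 1 -> s0 <= Num.sqrt (1 - x ^+ 2) ->
    christoffel chebN (deriv_pair sg x N r s) M2 <=
    christoffel chebN (deriv_pair sg x N r s) M1 + B * (M2 - M1)%:R.
Proof.
move=> s0_gt0; have [B B0 hB] := deriv_pair_chebN_le r s s0 s0_gt0.
exists (B ^+ 2 + 1); first by rewrite ltr_wpDl ?sqr_ge0.
move=> M1 M2 N sg x N0 M12 M2N sg1 x1 sx.
rewrite /christoffel -!(big_mkord xpredT (fun k => deriv_pair sg x N r s (chebN k) ^+ 2)).
rewrite (big_cat_nat (n := M1))//= lerD2l mulr_natr -sumr_const_nat.
apply: ler_sum_nat => k /andP[_ kM2]; rewrite -[leLHS]ger0_norm ?sqr_ge0// normrX.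
rewrite (@le_trans _ _ (B ^+ 2)) ?lerDl// lerXn2r ?nnegrE//.
by apply: hB => //; rewrite (leq_trans (ltnW kM2)).
Qed.

(** Here [X] and [Y] stand for the extremal values of [mu] and of the arcsine measure divided by
    [n], and [q] for the ratio of densities. Since [eta] depends only on [C], [q0] and [e], the
    conclusion is uniform in the point and in [n]. *)
Lemma transfer_limit (C q0 e : R) : 0 < C -> 0 < q0 -> 0 < e -> exists2 eta, 0 < eta < q0 &
  forall X Y q, 0 <= X -> 0 <= Y <= C -> q0 <= q ->
    X <= ((q - eta)^-1 + eta) * (Y + eta) -> Y - eta <= (q + eta + eta) * X ->
    `|X - Y / q| <= e.
Proof.
move=> C0 q00 e0.
(* The upper inequality gives [X <= Y / q + eta * A], with [eta <= q0 / 2] used to bound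
   [1 / (q - eta)] by [2 / q0]. Hence [X <= B], and the lower inequality loses at most
   [eta * (1 + 2 * B) / q0]. *)
pose A := 2 * C / q0 ^+ 2 + C + 2 / q0 + 1.
have A1 : 1 <= A by rewrite lerDr !addr_ge0 ?divr_ge0 ?mulr_ge0 ?exprn_ge0// ltW.
pose B := C / q0 + A.
have B0 : 0 <= B by rewrite addr_ge0 ?divr_ge0 ?(le_trans _ A1)// ltW.
pose eta := Num.min (Num.min 1 (q0 / 2)) (Num.min (e / A) (e * q0 / (1 + 2 * B))).
have A0 : 0 < A by lra.
have B1 : 0 < 1 + 2 * B by lra.
have eta0 : 0 < eta by rewrite !lt_min ltr01 !divr_gt0// mulr_gt0.
have [eta1 eta2 eta3 eta4] : [/\ eta <= 1, eta <= q0 / 2, eta * A <= e &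
    eta * (1 + 2 * B) <= e * q0].
  by split; rewrite -?ler_pdivlMr// !ge_min lexx ?orbT.
exists eta => [|X Y q X0 /andP[Y0 YC] q0q h1 h2].
  by rewrite eta0/= (le_lt_trans eta2)//; lra.
clearbody eta.
have q_gt0 : 0 < q by lra.
have qe0 : 0 < q - eta by lra.
set u := q^-1; set v := (q - eta)^-1; set u0 := q0^-1 in A1 A0 B0 B1 *.
have u_gt0 : 0 < u by rewrite invr_gt0.
have u0_gt0 : 0 < u0 by rewrite invr_gt0.
have uu0 : u <= u0 by rewrite lef_pV2.
have vu0 : v <= 2 * u0.
  by rewrite /v /u0 -[2 * _]invrK lef_pV2 ?posrE ?invfM ?invrK//; lra.
have vu : v = u + eta * (u * v) by rewrite /v /u; field; rewrite !lt0r_neq0.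
have v_gt0 : 0 < v by rewrite invr_gt0.
have uv : u * v <= 2 * u0 ^+ 2.
  by rewrite expr2 mulrCA; apply: ler_pM => //; exact: ltW.
have AE : A = 2 * C * u0 ^+ 2 + C + 2 * u0 + 1 by rewrite /A exprVn.
have X_le : X <= Y * u + eta * A.
  rewrite (le_trans h1)// AE -/v {1}vu.
  have : Y * (u * v) <= C * (2 * u0 ^+ 2) by apply: ler_pM => //; rewrite mulr_ge0// ltW.
  have : eta * (eta * (u * v)) <= 1 * (eta * (u * v)).
    by apply: ler_wpM2r => //; rewrite !mulr_ge0 ?ltW.
  have : eta * v <= eta * (2 * u0) by rewrite ler_pM2l.
  have : eta * Y <= eta * C by rewrite ler_pM2l.
  have : eta * eta <= eta * 1 by rewrite ler_pM2l.
  move=> k1 k2 k3 _ k5.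
  have k6 : eta * (Y * (u * v)) <= eta * (C * (2 * u0 ^+ 2)) by rewrite ler_pM2l.
  have k7 : (u + eta * (u * v)) * eta = eta * v by rewrite -vu mulrC.
  by move: k1 k2 k3 k6 k7; lra.
have YB : Y * u <= C * u0 by apply: ler_pM => //; exact: ltW.
have XB : X <= B.
  have := ler_wpM2r (ltW A0) eta1; rewrite mul1r /B -/u0; lra.
have eB : eta * (1 + 2 * B) * u0 <= e.
  by rewrite -ler_pdivlMr ?invr_gt0// invrK.
rewrite ler_norml; apply/andP; split; last by move: X_le eta3; lra.
have k1 : Y * u <= (q + eta + eta) * X * u + eta * u.
  by rewrite -mulrDl; apply: ler_wpM2r; [exact: ltW|lra].
have k2 : (q + eta + eta) * X * u = X + 2 * eta * (X * u).
  by rewrite /u; field; exact: lt0r_neq0.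
have k3 : X * u <= B * u0 by apply: ler_pM => //; exact: ltW.
have k4 : eta * (X * u) <= eta * (B * u0) by rewrite ler_pM2l.
have k5 : eta * u <= eta * u0 by rewrite ler_pM2l.
by move: k1 k2 k4 k5 eB; lra.
Qed.
End derivative_functional.

(** * Uniform bounds from regularity *)

From mathcomp Require Import complex.

Section regularity.
Import Normc.
Local Open Scope complex_scope.

Section complex_lemmas.
Context {R : realType}.
Implicit Types (t : R) (z : R[i]).

Lemma normcE z : `|z| = (normc z)%:C. Proof. by []. Qed.

Lemma normc_ge0 z : 0 <= normc z.
Proof. by rewrite -ler0c -normcE normr_ge0. Qed.

Lemma normcX z n : normc (z ^+ n) = normc z ^+ n.
Proof. by elim: n => [|n IHn]; rewrite ?normc1// !exprS normcM IHn. Qed.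

Lemma Re_le_normc z : `|Re z| <= normc z.
Proof.
case: z => a b /=; rewrite -sqrtr_sqr ler_wsqrtr// lerDl sqr_ge0 //.
Qed.

Lemma normc_conj z : normc z^* = normc z.
Proof. by case: z => a b /=; rewrite sqrrN. Qed.

Lemma normc_real t : normc t%:C = `|t|.
Proof. by rewrite /normc/= expr0n addr0 sqrtr_sqr. Qed.

Lemma Re_divc (w z : R[i]) : Re (w / z) = Re (w * z^*) / normc z ^+ 2.
Proof.
case: w z => a b [c d] /=; rewrite sqr_sqrtr ?addr_ge0 ?sqr_ge0//; ring.
Qed.

Lemma mulc_conj z : z^* * z = (normc z ^+ 2)%:C.
Proof.
case: z => a b /=; rewrite sqr_sqrtr ?addr_ge0 ?sqr_ge0//.
by simpc; congr (_ +i* _); ring.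
Qed.

Lemma Re_mulcr w t : Re (w * t%:C) = Re w * t.
Proof. by case: w => a b /=; rewrite mulr0 subr0. Qed.

Lemma ReB (w z : R[i]) : Re (w - z) = Re w - Re z.
Proof. by case: w z => a b []. Qed.

(** On the real line its values are the real parts of those of [P]; this lets the real functional
    [I] act on identities with a complex parameter [z]. *)
Definition Re_poly (P : {poly R[i]}) : {poly R} := \poly_(i < size P) Re P`_i.

Lemma size_Re_poly P : (size (Re_poly P) <= size P)%N.
Proof. exact: size_poly. Qed.

Lemma horner_Re_poly P t : (Re_poly P).[t] = Re P.[t%:C].
Proof.
have ReS (m : nat) (f : nat -> R[i]) :
    Re (\sum_(i < m) f i) = \sum_(i < m) Re (f i).
  elim: m => [|m IHm]; first by rewrite !big_ord0.
  by rewrite !big_ord_recr/= -IHm; case: (\sum_(_ < _) _) => ? ?; case: (f m).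
rewrite horner_poly horner_coef (ReS _ (fun i => P`_i * t%:C ^+ i)).
apply: eq_bigr => i _; rewrite -rmorphXn/=.
by case: P`_i => x y /=; rewrite mulr0 subr0.
Qed.

(* [1 - 2 t z + z ^ 2] is a convex combination of [(1 - z) ^ 2] and
   [(1 + z) ^ 2], whose scalar products with [1 - z ^ 2] are positive. *)
Lemma Re_cheb_denom z t : -1 <= t <= 1 -> normc z < 1 ->
  (1 - normc z ^+ 2) * (1 - normc z) ^+ 2 <=
  Re ((1 - z ^+ 2) * (1 - 2 * t%:C * z + z ^+ 2)^*).
Proof.
move=> /andP[t0 t1] z1; set rho := normc z.
have rho0 : 0 <= rho by exact: normc_ge0.
have rho2 : rho ^+ 2 = Re z ^+ 2 + Im z ^+ 2.
  by rewrite /rho; case: (z) => a b /=; rewrite sqr_sqrtr// addr_ge0 ?sqr_ge0.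
have := Re_le_normc z; rewrite -/rho ler_norml.
case: z @rho z1 rho0 rho2 => a b rho z1 rho0 rho2 /andP[].
rewrite [Re (a +i* b)]/= => a0 a1; rewrite [Re _]/= [Im _]/= in rho2.
have -> : Re ((1 - (a +i* b) ^+ 2) * (1 - 2 * t%:C * (a +i* b) + (a +i* b) ^+ 2)^*) =
    (1 - (a ^+ 2 + b ^+ 2)) * ((1 + t) / 2 * (1 - 2 * a + (a ^+ 2 + b ^+ 2)) +
        (1 - t) / 2 * (1 + 2 * a + (a ^+ 2 + b ^+ 2))).
  have -> : (2 : R[i]) = 2%:C by rewrite rmorph_nat.
  rewrite !expr2 -[1 : R[i]]/(1 +i* 0); simpc => /=; by field.
rewrite -rho2.
have h : 0 <= 1 - rho ^+ 2 by rewrite subr_ge0 exprn_ile1// ltW.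
clearbody rho; apply: ler_wpM2l => //.
have -> : (1 - rho) ^+ 2 = (1 + t) / 2 * (1 - rho) ^+ 2 + (1 - t) / 2 * (1 - rho) ^+ 2.
  by field.
apply: lerD; apply: ler_wpM2l; rewrite ?divr_ge0 ?subr_ge0//; try lra; nra.
Qed.

End complex_lemmas.

Section joukowski.
Context {R : realType}.
Implicit Types (t : R) (z : R[i]).

Lemma map_cheb k : (map_poly (real_complex R) (chebT k) = chebT k) /\
  (map_poly (real_complex R) (chebV k) = chebV k).
Proof.
elim: k => [|k [hT hV]].
  by rewrite !chebT0 !chebV0 rmorph0 rmorph1.
have e : map_poly (real_complex R) (1 - 'X ^+ 2) = 1 - 'X ^+ 2.
  by rewrite rmorphB rmorph1 /= map_polyXn.
by rewrite !chebTS !chebVS rmorphB rmorphD !rmorphM /= e map_polyX hT hV.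
Qed.

Lemma chebV_complex k t : (chebV k).[t%:C] = ((chebV k).[t])%:C.
Proof. by rewrite -(map_cheb k).2 horner_map. Qed.

(** Truncated generating function of the Chebyshev polynomials of the second kind. It provides a
    polynomial in [t] close to [1 / (1 - 2 t z + z ^ 2)], with a remainder of order [n |z| ^ n] on
    [[-1, 1]]. *)
Lemma chebV_generating z t n :
  (1 - 2 * t%:C * z + z ^+ 2) * \sum_(k < n) z ^+ k * (chebV k.+1).[t%:C] =
  1 - (z ^+ n * (chebV n.+1).[t%:C] - z ^+ n.+1 * (chebV n).[t%:C]).
Proof.
elim: n => [|n IHn].
  by rewrite big_ord0 chebVS chebT0 chebV0 !hornerE; ring.
rewrite big_ord_recr/= mulrDr IHn (chebVSS n) !hornerE !exprS.
rewrite /=; ring.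
Qed.

(** For [p] of degree [n] this is a polynomial in [z] of degree [2 n], except at [z = 0], where the
    convention [0^-1 = 0] gives another value; hence the restrictions to [z != 0] below. *)
Definition joukowski (p : {poly R}) n z :=
  z ^+ n * (map_poly (real_complex R) p).[(z + z^-1) / 2].

End joukowski.

(** * Lower bound inside the unit disc from orthogonality *)

Section lower_bound.
Context {R : realType} (I : {scalar {poly R}}) (p : nat -> {poly R}).
Hypothesis I_ge0 : forall P : {poly R},
  (forall t, -1 < t < 1 -> 0 <= P.[t]) -> 0 <= I P.
Hypothesis size_p : forall n, size (p n) = n.+1.
Hypothesis orth_p : forall m n, I (p m * p n) = (m == n)%:R.

(* With [F = z ^ n p_n ((z + 1 / z) / 2)] and [V t = 1 - 2 t z + z ^ 2], the quotient of
   [F - z ^ n p_n t] by [V t] is a polynomial of degree less than [n] in [t], hence orthogonal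
   to [p_n]. *)
Lemma joukowski_lower n z : 0 < normc z < 1 ->
  ((1 - normc z ^+ 2) * (1 - normc z) ^+ 2) ^+ 2 / (64 * n.+1%:R * (I 1 + 1)) <=
  normc (joukowski (p n) n z).
Proof.
move=> /andP[z_gt0 z_lt1]; set rho := normc z in z_gt0 z_lt1 *.
have z0 : z != 0 by apply/eqP => z0; move: z_gt0; rewrite /rho z0 normc0 ltxx.
have two0 : (2 : R[i]) != 0 by rewrite pnatr_eq0.
set ka := (1 - rho ^+ 2) * (1 - rho) ^+ 2.
have ka_gt0 : 0 < ka by rewrite mulr_gt0 ?exprn_gt0 ?subr_gt0 ?exprn_ilt1// ltW.
set F := joukowski (p n) n z; set f := normc F.
have f0 : 0 <= f by exact: normc_ge0.
pose V t : R[i] := 1 - 2 * t%:C * z + z ^+ 2.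
have V_Re t : -1 <= t <= 1 -> ka <= Re ((1 - z ^+ 2) * (V t)^*).
  by move=> t1; exact: Re_cheb_denom.
have n2 (w : R[i]) : normc (1 + w) <= 1 + normc w.
  by rewrite (le_trans (le_normcD _ _))// normc1.
have nz2 : normc (1 - z ^+ 2) <= 2.
  rewrite (le_trans (n2 _))// normcN normcX -/rho.
  by have := exprn_ile1 2 (ltW z_gt0) (ltW z_lt1); lra.
have V_ge t : -1 <= t <= 1 -> ka / 2 <= normc (V t).
  move=> /V_Re h; rewrite ler_pdivrMr// mulrC (le_trans h)//.
  rewrite (le_trans (ler_norm _))// (le_trans (Re_le_normc _))//.
  by rewrite normcM normc_conj ler_wpM2r// normc_ge0.
have V_le t : -1 <= t <= 1 -> normc (V t) <= 4.
  move=> /andP[t0 t1]; rewrite /V -addrA (le_trans (n2 _))//.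
  suff : normc (- (2 * t%:C * z) + z ^+ 2) <= 3 by lra.
  rewrite (le_trans (le_normcD _ _))// normcN !normcM normc_real.
  have -> : normc (2 : R[i]) = 2.
    by rewrite (_ : 2 = 2%:C) ?normc_real ?normr_nat// rmorph_nat.
  rewrite -/rho; have t2 : `|t| <= 1 by rewrite ler_norml t0.
  have : `|t| * rho <= 1 by rewrite mulr_ile1// ltW.
  by have : rho * rho <= 1 by [rewrite mulr_ile1// ltW|]; lra.
pose pC := map_poly (real_complex R) (p n).
pose y := (z + z^-1) / 2.
have [q pq] : exists q, pC - pC.[y]%:P = q * ('X - y%:P).
  by apply/factor_theorem; rewrite /root !hornerE subrr.
have size_pC : size pC = n.+1 by rewrite size_map_inj_poly// ?size_p//; exact: complexI.
have size_q : (size q <= n)%N.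
  have [->|q0] := eqVneq q 0; first by rewrite size_poly0.
  have : (size (pC - pC.[y]%:P)%R <= n.+1)%N.
    rewrite (leq_trans (size_polyD _ _))// size_polyN geq_max size_pC leqnn/=.
    by rewrite (leq_trans (size_polyC_leq1 _)).
  by rewrite pq size_Mmonic ?monicXsubC// size_XsubC addn2.
pose Q := (z ^+ n / (2 * z)) *: q.
have QV t : Q.[t%:C] * V t = F - z ^+ n * ((p n).[t])%:C.
  have -> : ((p n).[t])%:C = pC.[t%:C] by rewrite horner_map.
  have -> : pC.[t%:C] = pC.[y] + q.[t%:C] * (t%:C - y).
    by have := congr1 (fun P => P.[t%:C]) pq; rewrite !hornerE => <-; ring.
  rewrite /F /joukowski -/pC -/y hornerZ /V /y; field.
  by rewrite z0.
(* Orthogonality to [Q] alone amounts to [F * I (p / V) = z ^ n * I (p ^ 2 / V)], which loses a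
   factor [rho ^ n]. Subtracting [F *: S], where [S] truncates the expansion of [1 / V], replaces
   [p / V] by [p * W / V], and the size of [W] matches that of [z ^ n]. *)
pose S := \sum_(k < n) z ^+ k *: (chebV k.+1 : {poly R[i]}).
pose W t : R[i] := z ^+ n * (chebV n.+1).[t%:C] - z ^+ n.+1 * (chebV n).[t%:C].
have SV t : V t * S.[t%:C] = 1 - W t.
  rewrite -chebV_generating horner_sum; congr (_ * _).
  by apply: eq_bigr => k _; rewrite hornerZ.
have size_S : (size S <= n)%N.
  apply: (leq_trans (size_sum _ _ _)); apply/bigmax_leqP => k _.
  by rewrite (leq_trans (size_scale_leq _ _))// (leq_trans (size_cheb _).2).
(* The power of the conjugate turns [z ^ n] into the positive number [rn], and [1 - z ^ 2] makes the
   real part of [u = (1 - z ^ 2) / V] positive. *)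
pose la := (1 - z ^+ 2) * (z^* ) ^+ n.
pose G := la *: (Q - F *: S).
have size_G : (size (Re_poly G) <= n)%N.
  rewrite (leq_trans (size_Re_poly _))// (leq_trans (size_scale_leq _ _))//.
  rewrite (leq_trans (size_polyD _ _))// size_polyN geq_max.
  by rewrite !(leq_trans (size_scale_leq _ _)).
have IG : I (p n * Re_poly G) = 0 by exact: (orthonormal_orthogonal I p).
have Wn t : -1 <= t <= 1 -> normc (W t) <= 2 * n.+1%:R * rho ^+ n.
  move=> t1; rewrite (le_trans (le_normcD _ _))// normcN !normcM !normcX -/rho.
  rewrite !chebV_complex !normc_real.
  have v1 := norm_chebV_le n.+1 _ t1; have v0 := norm_chebV_le n _ t1.
  rewrite -mulrA mulr_natl mulr2n; apply: lerD; rewrite mulrC.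
    by rewrite ler_wpM2r ?exprn_ge0// ltW.
  rewrite exprS -mulrCA mulrA; apply: ler_pM; rewrite ?mulr_ge0 ?exprn_ge0 ?(ltW z_gt0)//.
  rewrite mulrC; apply: (@le_trans _ _ `|(chebV n).[t]|); first by rewrite ler_piMr// ltW.
  by rewrite (le_trans v0)// ler_nat.
pose rn := rho ^+ n * rho ^+ n.
have rn_gt0 : 0 < rn by rewrite mulr_gt0// exprn_gt0.
have I1_ge0 : 0 <= I 1 by apply: I_ge0 => t _; rewrite hornerC.
(* [2 * A] bounds the part of [G] containing [W], and [2 |p| <= 1 + p ^ 2] then gives
   [A * (1 + p ^ 2)]. [B] comes from [Re u >= ka / 16], as [|V| <= 4]. Comparing [A * (I 1 + 1)]
   with [B] produces the constant [64 = 4 * 16]. *)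
pose A := rn * (4 / ka) * n.+1%:R * f; pose B := rn * (ka / 16).
have key : 0 <= I (A *: (1 + p n * p n) - B *: (p n * p n) - p n * Re_poly G).
  apply: I_ge0 => t tI; have t1 : -1 <= t <= 1 by case/andP: tI => ? ?; rewrite !ltW.
  have nV : ka / 2 <= normc (V t) by exact: V_ge.
  have V0 : V t != 0.
    apply/eqP => V0; move: nV; rewrite V0 normc0.
    by rewrite leNgt divr_gt0.
  set u := (1 - z ^+ 2) / V t.
  have u_le : normc u <= 4 / ka.
    rewrite normcM normcV ler_pdivlMr// mulrAC ler_pdivrMr; last first.
      by rewrite (lt_le_trans _ nV)// divr_gt0.
    apply: (@le_trans _ _ (2 * ka)); first by rewrite ler_wpM2r// ltW.
    by move: nV; lra.
  have u_ge : ka / 16 <= Re u.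
    have nV_gt0 : 0 < normc (V t) by rewrite (lt_le_trans _ nV)// divr_gt0.
    rewrite Re_divc ler_pdivlMr ?exprn_gt0// (le_trans _ (V_Re t t1))//.
    rewrite -[leRHS]mulr1 -mulrA ler_pM2l// ler_pdivrMl// mulr1.
    have := V_le t t1; nra.
  have Gt : G.[t%:C] = u * (z^* ) ^+ n * F * W t - u * (rn * (p n).[t])%:C.
    have -> : (rn * (p n).[t])%:C = (z^* ) ^+ n * z ^+ n * ((p n).[t])%:C.
      by rewrite -exprMn mulc_conj -rmorphXn -rmorphM/= -exprM mulnC exprM expr2.
    have e : (Q.[t%:C] - F * S.[t%:C]) * V t = F * W t - z ^+ n * ((p n).[t])%:C.
      by rewrite mulrBl QV -mulrA [S.[_] * _]mulrC SV; ring.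
    apply: (mulIf V0); rewrite /G hornerZ hornerD hornerN [(F *: S).[_]]hornerZ.
    by rewrite -[LHS]mulrA e /la /u; field.
  have ReG : `|(p n).[t] * (Re_poly G).[t] + rn * Re u * (p n).[t] ^+ 2| <=
      A * (1 + (p n).[t] ^+ 2).
    rewrite horner_Re_poly Gt ReB Re_mulcr.
    set X := u * _ * _ * _.
    have -> : (p n).[t] * (Re X - Re u * (rn * (p n).[t])) + rn * Re u * (p n).[t] ^+ 2 =
       (p n).[t] * Re X by ring.
    have X_le : normc X <= 2 * A.
      rewrite /X 3!normcM [normc (z^* ^+ n)]normcX normc_conj -/rho -/f /A /rn.
      apply: (@le_trans _ _ (4 / ka * rho ^+ n * f * (2 * n.+1%:R * rho ^+ n))).
        apply: ler_pM; rewrite ?mulr_ge0 ?normc_ge0 ?exprn_ge0 ?(ltW z_gt0)//; last exact: Wn.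
        by rewrite !ler_wpM2r// exprn_ge0// ltW.
      by rewrite le_eqVlt; apply/orP; left; apply/eqP; ring.
    have p_le : `|(p n).[t]| <= (1 + (p n).[t] ^+ 2) / 2.
      have : 0 <= (`|(p n).[t]| - 1) ^+ 2 by exact: sqr_ge0.
      by rewrite -(real_normK (num_real (p n).[t])); lra.
    rewrite normrM; apply: (@le_trans _ _ ((1 + (p n).[t] ^+ 2) / 2 * (2 * A))).
      by apply: ler_pM => //; exact: le_trans (Re_le_normc _) X_le.
    by rewrite le_eqVlt; apply/orP; left; apply/eqP; field.
  rewrite !hornerE /=.
  move: (le_trans (ler_norm _) ReG).
  have : rn * (ka / 16) * (p n).[t] ^+ 2 <= rn * Re u * (p n).[t] ^+ 2.
    by rewrite ler_wpM2r ?sqr_ge0// ler_wpM2l// ltW.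
  rewrite /B; lra.
move: key; rewrite !linearB !linearZ linearD/= IG orth_p eqxx subr0 -[true%:R]/(1 : R).
rewrite /A /B ler_pdivrMr ?mulr_gt0//; last by rewrite ltr_wpDl.
rewrite scalerN /GRing.scale/=.
have -> : rn * (4 / ka) * n.+1%:R * f * (I 1 + 1) - rn * (ka / 16) * 1 =
   rn * 4 / ka * (f * (n.+1%:R * (I 1 + 1)) - ka ^+ 2 / 64).
  by rewrite /=; field; exact: lt0r_neq0.
rewrite pmulr_rge0; last by rewrite divr_gt0// (mulr_gt0 rn_gt0).
by lra.
Qed.
End lower_bound.

(** * Subexponential growth *)

Section growth.
Context {R : realType}.
Implicit Types b x : R.

(** Several exponential losses must together stay below [b ^ n], so each is given a base whose fixed
    power is at most [b]. The witness rests on [(1 + x) ^ j <= 1 + 3 ^ j * x] for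
    [0 <= x <= 1 / 2]. *)
Lemma exists_small_root b k : 1 < b -> exists b', [/\ 1 < b', b' < 2 & b' ^+ k <= b].
Proof.
move=> b1; pose x := Num.min (1 / 2) ((b - 1) / 3 ^+ k).
have k3 : 0 < 3 ^+ k :> R by rewrite exprn_gt0.
have x0 : 0 < x by rewrite lt_min divr_gt0 ?divr_gt0 ?subr_gt0.
have x1 : x <= 1 / 2 by rewrite ge_min lexx.
have xb : 3 ^+ k * x <= b - 1.
  by rewrite mulrC -ler_pdivlMr// ge_min lexx orbT.
exists (1 + x); split; [lra|lra|].
suff /(_ k) : forall j, (1 + x) ^+ j <= 1 + 3 ^+ j * x by move: xb; lra.
clearbody x; elim=> [|j IHj]; first by rewrite !expr0 mul1r; lra.
rewrite exprSr (le_trans (ler_wpM2r _ IHj))//; first by lra.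
have : 1 <= 3 ^+ j :> R by rewrite exprn_ege1// ler1n.
rewrite [3 ^+ j.+1]exprS; set y := 3 ^+ j => y1.
have : 0 <= y * x * (1 / 2 - x) by rewrite !mulr_ge0 ?subr_ge0//; lra.
have : 0 <= (y - 1) * x by rewrite !mulr_ge0 ?subr_ge0// ltW.
lra.
Qed.

Lemma succn_expn_le b k : 1 < b -> exists2 C, 0 < C &
  forall n, n.+1%:R ^+ k <= C * b ^+ n.
Proof.
move=> b1; have [b' [b'1 _ b'k]] := exists_small_root b k b1.
have x0 : 0 < b' - 1 by rewrite subr_gt0.
pose D := (b' - 1)^-1 + 1.
have D0 : 0 < D by rewrite addr_gt0// invr_gt0.
exists (D ^+ k); first exact: exprn_gt0.
move=> n; apply: (@le_trans _ _ ((D * b' ^+ n) ^+ k)); last first.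
  rewrite exprMn ler_pM2l ?exprn_gt0// -exprM mulnC exprM.
  by rewrite lerXn2r ?nnegrE ?exprn_ge0//; lra.
have b'0 : 0 <= b' by lra.
rewrite lerXn2r ?nnegrE ?mulr_ge0 ?exprn_ge0 ?(ltW D0)//.
have bern : 1 + n%:R * (b' - 1) <= b' ^+ n.
  elim: n => [|n IHn]; first by rewrite mul0r addr0.
  rewrite exprS (le_trans _ (ler_wpM2l _ IHn))//.
  have : 0 <= n%:R * (b' - 1) ^+ 2 by rewrite mulr_ge0 ?sqr_ge0.
  by rewrite -natr1; lra.
apply: (@le_trans _ _ (D * (1 + n%:R * (b' - 1)))); last by rewrite ler_pM2l.
have -> : D * (1 + n%:R * (b' - 1)) = n.+1%:R + (b' - 1)^-1 + n%:R * (b' - 1).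
  by rewrite /D -natr1; field; rewrite lt0r_neq0.
by rewrite -addrA lerDl addr_ge0 ?invr_ge0 ?mulr_ge0// ltW.
Qed.

Lemma eventually_expn_le (a : nat -> R) b n0 : 1 <= b -> (forall n, 0 <= a n) ->
  (forall n, (n0 <= n)%N -> a n <= b ^+ n) ->
  exists2 K, 0 < K & forall n, a n <= K * b ^+ n.
Proof.
move=> b1 a0 ab; exists (1 + \sum_(i < n0) a i).
  by rewrite ltr_pwDl// sumr_ge0.
move=> n; rewrite mulrDl mul1r; case: (leqP n0 n) => nn0.
  rewrite (le_trans (ab n nn0))// lerDl mulr_ge0 ?sumr_ge0// exprn_ge0//.
  by rewrite (le_trans _ b1).
rewrite -[leLHS]add0r lerD ?exprn_ge0 ?(le_trans _ b1)//.
apply: (@le_trans _ _ (\sum_(i < n0) a i)).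
  by rewrite (bigD1 (Ordinal nn0))//= lerDl sumr_ge0.
by rewrite ler_peMr ?sumr_ge0// exprn_ege1.
Qed.

(** The quantity raised to the power [M] is the value at 0 of the polynomial [F]; the power arises
    because Harnack's argument multiplies [M] values of [F]. *)
Lemma leading_coef_growth (p : nat -> {poly R}) b M : 1 < b ->
  (forall n, 0 < lead_coef (p n)) -> regular_polys p ->
  exists2 K, 0 < K & forall n, (lead_coef (p n) / 2 ^+ n) ^+ M <= K * b ^+ n.
Proof.
move=> b1 lp reg; have [b' [b'1 b'2 b'M]] := exists_small_root b M b1.
have pos n : 0 <= lead_coef (p n) / 2 ^+ n by rewrite divr_ge0 ?exprn_ge0 ?ltW.
have : \forall n \near \oo, lead_coef (p n) `^ n%:R^-1 < 2 * b'.
  by apply: (cvgr_lt _ reg); lra.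
(* Starting at [n0.+1] excludes [n = 0], where the inverse exponent is 0 and the [n]-th root cannot
   be undone. *)
move=> [n0 _ hn0]; apply: (@eventually_expn_le _ b n0.+1); first exact: ltW.
  by move=> n; rewrite exprn_ge0.
move=> n nn0; apply: (@le_trans _ _ ((b' ^+ n) ^+ M)); last first.
  by rewrite -exprM mulnC exprM lerXn2r ?nnegrE ?exprn_ge0//; lra.
rewrite lerXn2r ?nnegrE ?exprn_ge0//; first by lra.
rewrite ler_pdivrMr ?exprn_gt0// -exprMn [b' * 2]mulrC.
have /ltW h := hn0 n (ltnW nn0).
have n_neq0 : n%:R != 0 :> R by rewrite pnatr_eq0 -lt0n (leq_trans _ nn0).
have -> : lead_coef (p n) = (lead_coef (p n) `^ n%:R^-1) ^+ n.
  by rewrite -powR_mulrn ?powR_ge0// -powRrM mulVf// powRr1// ltW.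
by rewrite lerXn2r ?nnegrE ?powR_ge0//; lra.
Qed.

End growth.

(** * Discrete Harnack inequality and passage between circles *)

Section harnack.
Context {R : realType}.
Implicit Types (z u h : R[i]) (hs : seq R[i]).

Lemma normc_prod {T : Type} (s : seq T) (F : T -> R[i]) :
  normc (\prod_(i <- s) F i) = \prod_(i <- s) normc (F i).
Proof. exact: (big_morph _ (@normcM R) (@normc1 R)). Qed.

Lemma prod_seq_le {T : eqType} (s : seq T) (F G : T -> R) (k : R) :
  (forall i, i \in s -> 0 <= F i <= k * G i) ->
  \prod_(i <- s) F i <= k ^+ size s * \prod_(i <- s) G i.
Proof.
elim: s => [|i s IHs] FG; first by rewrite !big_nil expr0 mulr1.
rewrite !big_cons/= exprS mulrACA; have /andP[F0 Fk] := FG i (mem_head _ _).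
apply: ler_pM => //; last by apply: IHs => j js; rewrite FG// in_cons js orbT.
rewrite big_seq prodr_ge0// => j js.
by have /andP[] : 0 <= F j <= k * G j by rewrite FG// in_cons js orbT.
Qed.

Lemma normc1B_le u : normc (1 - u) <= 1 + normc u.
Proof. by rewrite (le_trans (le_normcD _ _))// normcN normc1. Qed.

(** The sequence comes from splitting ['X^M - 1] over an algebraically closed field; the product
    formula is this factorization at [u^-1], multiplied by [u ^ M]. *)
Lemma roots_of_unity M : (0 < M)%N -> exists ws : seq R[i],
  [/\ size ws = M, 1 \in ws, forall h, h \in ws -> normc h = 1 &
    forall u, \prod_(h <- ws) (1 - u * h) = 1 - u ^+ M].
Proof.
move=> M0; have [ws wsE] := closed_field_poly_normal ('X^M - 1 : {poly R[i]}).
have mon : 'X^M - 1 \is @monic R[i] by exact: monicXnsubC.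
rewrite (monicP mon) scale1r in wsE.
have wsP h : (h \in ws) = (h ^+ M == 1).
  rewrite -root_prod_XsubC -wsE /root !hornerE subr_eq0 //.
have sz : size ws = M.
  by apply: succn_inj; rewrite -(size_prod_XsubC ws id) -wsE size_XnsubC.
exists ws; split => // [|h|u]; first by rewrite wsP expr1n.
  rewrite wsP => /eqP /(congr1 (@normc R)); rewrite normcX normc1 => /eqP.
  by rewrite pexpr_eq1 ?normc_ge0// => /eqP.
have [->|u0] := eqVneq u 0.
  rewrite big1 => [|h _]; last by rewrite mul0r subr0.
  by rewrite expr0n gtn_eqF// subr0.
have : u ^+ M * ('X^M - 1 : {poly R[i]}).[u^-1] =
       u ^+ M * \prod_(h <- ws) (u^-1 - h).
  rewrite wsE horner_prod; congr (_ * _); apply: eq_bigr => h _.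
  by rewrite !hornerE.
rewrite !hornerE mulrBr mulr1 -exprMn mulfV// expr1n => ->.
rewrite -sz; elim: (ws) => [|h s IHs]; first by rewrite !big_nil mulr1.
by rewrite !big_cons /= exprS mulrACA IHs mulrBr mulfV.
Qed.

(* The mean value property of [log |1 - h z|] over the [M]-th roots of unity
   turns a lower bound on a circle into an upper bound. *)
Lemma discrete_harnack (F : R[i] -> R[i]) (f0 : R) hs M (rho c : R) :
  (0 < M)%N -> 0 <= f0 -> 0 < rho -> 0 <= c ->
  (forall h, h \in hs -> normc h <= 1) ->
  (forall z, z != 0 -> F z = f0%:C * \prod_(h <- hs) (1 - h * z)) ->
  (forall z, normc z = rho -> c <= normc (F z)) ->
  forall z, normc z = rho ->
    normc (F z) * c ^+ M.-1 <= f0 ^+ M * (1 + rho ^+ M) ^+ size hs.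
Proof.
move=> M0 f00 rho0 c0 hs1 FE Fc z zrho.
have [ws [sz ws1 wsn wsP]] := roots_of_unity M M0.
have z0 : z != 0 by apply/eqP => z0; move: rho0; rewrite -zrho z0 normc0 ltxx.
have zw h : h \in ws -> normc (z * h) = rho.
  by move=> /wsn h1; rewrite normcM h1 mulr1.
(* The root [w = 1] gives the value to be bounded; each of the [M - 1] others contributes at least
   [c]. *)
apply: (@le_trans _ _ (\prod_(w <- ws) normc (F (z * w)))).
  rewrite (perm_big _ (perm_to_rem ws1)) big_cons mulr1 ler_wpM2l ?normc_ge0//.
  have -> : M.-1 = size (rem 1 ws) by rewrite size_rem// sz.
  have : forall w, w \in rem 1 ws -> c <= normc (F (z * w)).
    by move=> w /mem_rem wws; rewrite Fc// zw.
  elim: (rem 1 ws) => [|w s IHs] cw; first by rewrite big_nil.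
  rewrite big_cons /= exprS ler_pM ?exprn_ge0//; first by rewrite cw ?mem_head.
  by apply: IHs => v vs; rewrite cw// in_cons vs orbT.
(* Exchanging the products replaces each [1 - h * z] by [1 - (h * z) ^ M], which is near 1 for large
   [M]: essentially only [f0 ^ M] survives. *)
have -> : \prod_(w <- ws) normc (F (z * w)) =
    f0 ^+ M * \prod_(h <- hs) normc (1 - (h * z) ^+ M).
  transitivity (\prod_(w <- ws) (f0 * \prod_(h <- hs) normc (1 - h * z * w))).
    rewrite big_seq [RHS]big_seq; apply: eq_bigr => w wws.
    rewrite FE; last first.
      apply/eqP => zw0; have := zw w wws; rewrite zw0 normc0 => /eqP.
      by rewrite lt_eqF.
    rewrite normcM normc_real ger0_norm// normc_prod; congr (_ * _).
    by apply: eq_bigr => h _; rewrite mulrA.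
  rewrite big_split/= big_const_seq count_predT iter_mulr_1 sz; congr (_ * _).
  by rewrite exchange_big; apply: eq_bigr => h _; rewrite -normc_prod wsP.
apply: ler_wpM2l; first exact: exprn_ge0.
apply: (le_trans (prod_seq_le hs _ (fun=> 1) (1 + rho ^+ M) _)); last first.
  by rewrite big1 ?mulr1.
move=> h hh; rewrite normc_ge0 mulr1.
rewrite (le_trans (normc1B_le _))// lerD2l normcX normcM zrho.
by rewrite lerXn2r ?nnegrE ?mulr_ge0 ?normc_ge0 ?(ltW rho0)// ler_piMl ?hs1 ?(ltW rho0).
Qed.

(** Factor by factor, [(1 + rho) |1 - u| <= 2 |1 - rho u|] for [|u| = 1]: the difference of the
    squares is [2 (1 + Re u) (1 - rho) ^ 2]. *)
Lemma unit_circle_shrink (F : R[i] -> R[i]) (f0 : R) hs (rho : R) :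
  0 <= f0 -> 0 < rho ->
  (forall h, h \in hs -> normc h = 1) ->
  (forall z, z != 0 -> F z = f0%:C * \prod_(h <- hs) (1 - h * z)) ->
  forall z, normc z = 1 ->
    normc (F z) <= (2 / (1 + rho)) ^+ size hs * normc (F (rho%:C * z)).
Proof.
move=> f00 rho0 hs1 FE z z1.
have z0 : z != 0 by apply/eqP => z0; move: z1; rewrite z0 normc0 => /eqP; rewrite lt_eqF.
have rz0 : rho%:C * z != 0.
  by rewrite mulf_neq0//; apply/eqP => -[] /eqP; rewrite gt_eqF.
rewrite !FE// !normcM mulrCA; apply: ler_wpM2l; first exact: normc_ge0.
rewrite !normc_prod; apply: prod_seq_le => h hh; rewrite normc_ge0/=.
rewrite [h * (_ * _)]mulrCA; set u := h * z.
have : normc u = 1 by rewrite normcM hs1// z1 mulr1.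
rewrite mulrAC ler_pdivlMr; last by rewrite addr_gt0.
case: u => a b; rewrite [normc _]/= => ab.
have {}ab : a ^+ 2 + b ^+ 2 = 1.
  by rewrite -[LHS]sqr_sqrtr ?ab ?expr1n// addr_ge0 ?sqr_ge0.
rewrite -[leLHS]ger0_norm ?mulr_ge0 ?normc_ge0 ?addr_ge0 ?(ltW rho0)//.
rewrite -[leRHS]ger0_norm ?mulr_ge0 ?normc_ge0//.
rewrite -ler_sqr ?nnegrE ?normr_ge0// !real_normK ?num_real// !exprMn.
rewrite -[1 : R[i]]/(1 +i* 0); simpc => /=.
rewrite !sqr_sqrtr ?addr_ge0 ?sqr_ge0//.
have a1 : -1 <= a.
  have : a ^+ 2 <= 1 by rewrite -ab lerDl sqr_ge0.
  by move=> a2; rewrite leNgt; apply/negP => a3; nra.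
have : 0 <= (1 + a) * (1 - rho) ^+ 2 by rewrite mulr_ge0 ?sqr_ge0//; lra.
have b2 : b ^+ 2 = 1 - a ^+ 2 by move: ab; lra.
rewrite !sqrrN [(rho * b) ^+ 2]exprMn b2; lra.
Qed.
End harnack.

(** * Growth of the orthonormal polynomials on [-1, 1] *)

Section sup_bound.
Context {R : realType}.
Implicit Types (z y h : R[i]).

Lemma joukowski_inv_root y : exists2 h, h != 0 & y = (h + h^-1) / 2.
Proof.
have two0 : (2 : R[i]) != 0 by rewrite pnatr_eq0.
pose h := y + sqrtC (y ^+ 2 - 1).
have hE : h * h - 2 * y * h + 1 = 0.
  by have := sqrtCK (y ^+ 2 - 1); rewrite /h; set s := sqrtC _ => e; ring: e.
have h0 : h != 0.
  by apply/eqP => h0; move: hE; rewrite h0 !mulr0 subr0 add0r => /eqP; rewrite oner_eq0.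
clearbody h; exists h => //; apply: (mulfI (mulf_neq0 two0 h0)); apply/eqP.
rewrite -subr_eq0 (_ : _ - _ = - (h * h - 2 * y * h + 1)); first by rewrite hE oppr0.
by field; rewrite h0.
Qed.

(* If no zero of [z ^ n p((z + 1/z)/2)] lies in the open unit disc, then, the zeros being
   closed under inversion, they all lie on the unit circle. *)
Lemma joukowski_factor (p : {poly R}) n : size p = n.+1 ->
  (forall z, 0 < normc z < 1 -> joukowski p n z != 0) ->
  exists hs : seq R[i], [/\ size hs = n.*2, forall h, h \in hs -> normc h = 1 &
    forall z, z != 0 ->
      joukowski p n z = (lead_coef p / 2 ^+ n)%:C * \prod_(h <- hs) (1 - h * z)].
Proof.
move=> szp nz; have two0 : (2 : R[i]) != 0 by rewrite pnatr_eq0.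
set pC := map_poly (real_complex R) p.
have lpC : lead_coef pC = (lead_coef p)%:C by rewrite lead_coef_map_inj//; exact: complexI.
have szpC : size pC = n.+1 by rewrite size_map_inj_poly// ?szp//; exact: complexI.
have [ys ysE] := closed_field_poly_normal pC.
have lp0 : lead_coef pC != 0 by rewrite lead_coef_eq0 -size_poly_eq0 szpC.
have size_ys : size ys = n.
  apply: succn_inj; rewrite -(size_prod_XsubC ys id) -szpC ysE size_scale//.
have circle y : y \in ys -> exists h, [/\ h != 0, normc h = 1 & y = (h + h^-1) / 2].
  move=> yys; have py0 : pC.[y] = 0.
    by rewrite ysE hornerZ; apply/eqP; rewrite mulf_eq0 -/(root _ _) root_prod_XsubC yys orbT.
  have [h h0 hy] := joukowski_inv_root y.
  have J0 (g : R[i]) : y = (g + g^-1) / 2 -> joukowski p n g = 0.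
    by move=> gy; rewrite /joukowski -gy py0 mulr0.
  have nh0 : 0 < normc h.
    by rewrite lt_neqAle normc_ge0 andbT eq_sym; apply: contra h0 => /eqP/eq0_normc ->.
  exists h; split => //; apply/eqP; rewrite eq_le; apply/andP; split.
    rewrite leNgt; apply/negP => h1.
    have := nz h^-1; rewrite J0 ?eqxx ?invrK 1?addrC// normcV invr_gt0 nh0.
    by rewrite invf_lt1// h1 => /(_ isT).
  rewrite leNgt; apply/negP => h1.
  by have := nz h; rewrite J0 ?eqxx// nh0 h1 => /(_ isT).
have [hs [szhs hs1 hsE]] : exists hs : seq R[i], [/\ size hs = (size ys).*2,
    forall h, h \in hs -> normc h = 1 & forall z, z != 0 ->
    \prod_(y <- ys) (z ^+ 2 - 2 * y * z + 1) = \prod_(h <- hs) (1 - h * z)].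
  elim: {size_ys ysE} ys circle => [|y ys IHys] circle.
    by exists [::]; split => // z _; rewrite !big_nil.
  have [|hs [szhs hs1 hsE]] := IHys.
    by move=> v vys; apply: circle; rewrite in_cons vys orbT.
  have [h [h0 h1 hy]] := circle y (mem_head _ _).
  exists [:: h, h^-1 & hs]; split; first by rewrite /= szhs doubleS.
    move=> g; rewrite !in_cons => /or3P[/eqP ->//|/eqP ->|/hs1//].
    by rewrite normcV h1 invr1.
  move=> z z0; rewrite !big_cons hsE// mulrA; congr (_ * _).
  by rewrite hy; field; rewrite h0.
exists hs; split => //; first by rewrite szhs size_ys.
move=> z z0; rewrite -hsE// /joukowski -/pC ysE hornerZ horner_prod lpC.
rewrite rmorphM/= fmorphV rmorphXn rmorph_nat mulrCA -mulrA; congr (_ * _).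
rewrite -{1 2}size_ys; elim: (ys) => [|y s IHs]; first by rewrite !big_nil !expr0 invr1 mulr1.
rewrite !big_cons/= [z ^+ (size s).+1]exprS [2 ^+ (size s).+1]exprS invfM.
rewrite mulrACA [RHS]mulrACA IHs; congr (_ * _).
by rewrite !hornerE; rewrite /=; field; rewrite z0.
Qed.

Variables (I : {scalar {poly R}}) (p : nat -> {poly R}).
Hypothesis I_ge0 : forall P : {poly R},
  (forall t, -1 < t < 1 -> 0 <= P.[t]) -> 0 <= I P.
Hypothesis size_p : forall n, size (p n) = n.+1.
Hypothesis lead_p : forall n, 0 < lead_coef (p n).
Hypothesis orth_p : forall m n, I (p m * p n) = (m == n)%:R.
Hypothesis reg_p : regular_polys p.

Lemma regular_sup_bound (b : R) : 1 < b -> exists2 C, 0 < C &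
  forall n t, -1 <= t <= 1 -> `|(p n).[t]| <= C * b ^+ n.
Proof.
(* The six powers of [be ^ n] are spent as follows: two on passing to the unit circle, where [rho]
   is chosen so that [2 / (1 + rho) = be]; one on the leading coefficient; one on the powers of
   [n + 1] from the lower bound; two on [(1 + rho ^ M) ^ (2 n)]. *)
move=> b1; have [be [be1 be2 be6]] := exists_small_root b 6 b1.
pose rho := 2 / be - 1.
have be0 : 0 < be by lra.
have rho0 : 0 < rho by rewrite subr_gt0 ltr_pdivlMr// mul1r.
have rho1 : rho < 1.
  by rewrite ltrBlDr ltr_pdivrMr//; lra.
have rhobe : 2 / (1 + rho) = be.
  by rewrite /rho subrKC invf_div mulrCA mulfV ?mulr1// pnatr_eq0.
have [M M0 rhoM] : exists2 M, (0 < M)%N & rho ^+ M <= be - 1.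
  have : \forall n \near \oo, rho ^+ n < be - 1.
    have h : rho ^+ n @[n --> \oo] --> (0 : R) by apply: cvg_expr; rewrite ger0_norm// ltW.
    by apply: (cvgr_lt _ h); rewrite subr_gt0.
  move=> [N _ hN]; exists N.+1 => //; apply: ltW; apply: hN => /=.
  exact: leqnSn.
have [K K0 hK] := leading_coef_growth p be M be1 lead_p reg_p.
have [D D0 hD] := succn_expn_le be M.-1 be1.
have I1_ge0 : 0 <= I 1 by apply: I_ge0 => t _; rewrite hornerC.
have I11 : 0 < I 1 + 1 by rewrite ltr_wpDl.
pose c := ((1 - rho ^+ 2) * (1 - rho) ^+ 2) ^+ 2 / (64 * (I 1 + 1)).
have r2 : 0 < 1 - rho ^+ 2 by rewrite subr_gt0 exprn_ilt1// ltW.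
have c0 : 0 < c.
  apply: divr_gt0; last by rewrite mulr_gt0.
  by rewrite exprn_gt0// mulr_gt0// exprn_gt0// subr_gt0.
exists (K * D / c ^+ M.-1); first by rewrite divr_gt0 ?mulr_gt0 ?exprn_gt0.
move=> n t t1.
have lowerJ z : 0 < normc z < 1 ->
    ((1 - normc z ^+ 2) * (1 - normc z) ^+ 2) ^+ 2 / (64 * n.+1%:R * (I 1 + 1)) <=
    normc (joukowski (p n) n z) by exact: (joukowski_lower I p).
have nzJ z : 0 < normc z < 1 -> joukowski (p n) n z != 0.
  move=> z01; have := lowerJ z z01; case/andP: z01 => z0 z1 h.
  apply/eqP => J0; move: h; rewrite J0 normc0 leNgt divr_gt0//.
    by rewrite exprn_gt0// mulr_gt0 ?exprn_gt0 ?subr_gt0// exprn_ilt1// ltW.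
  by rewrite !mulr_gt0.
have [hs [szhs hs1 hsE]] := joukowski_factor (p n) n (size_p n) nzJ.
have f0 : 0 <= lead_coef (p n) / 2 ^+ n by rewrite divr_ge0 ?exprn_ge0 ?ltW.
(* The point of the unit circle over [t], where the modulus of the Joukowski polynomial is [|p n|]
   at [t]. *)
pose e : R[i] := t +i* Num.sqrt (1 - t ^+ 2).
have t2 : 0 <= 1 - t ^+ 2.
  by move: t1 => /andP[? ?]; nra.
have e1 : normc e = 1 by rewrite /= sqr_sqrtr// subrKC sqrtr1.
have eV : (e + e^-1) / 2 = t%:C.
  have e0 : e != 0 by apply/eqP => e0; move: e1; rewrite e0 normc0 => /eqP; rewrite lt_eqF.
  have -> : e^-1 = conjc e.
    apply: (mulIf e0); rewrite mulVf//; have := mulc_conj e.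
    by rewrite e1 expr1n => /esym.
  by rewrite addcJ mulrAC mulfV ?mul1r// pnatr_eq0.
have Je : normc (joukowski (p n) n e) = `|(p n).[t]|.
  by rewrite /joukowski eV normcM normcX e1 expr1n mul1r horner_map normc_real.
have re : normc (rho%:C * e) = rho by rewrite normcM e1 mulr1 normc_real gtr0_norm.
have cn : 0 < c / n.+1%:R by rewrite divr_gt0.
have H := discrete_harnack _ _ hs M rho (c / n.+1%:R) M0 f0 rho0 (ltW cn) _ hsE _ _ re.
have S := unit_circle_shrink _ _ hs rho f0 rho0 hs1 hsE e e1.
rewrite -Je (le_trans S)// rhobe szhs.
have {}H : normc (joukowski (p n) n (rho%:C * e)) <=
    (K * D / c ^+ M.-1) * be ^+ n * be ^+ n * be ^+ n.*2.
  have cM : 0 < (c / n.+1%:R) ^+ M.-1 by rewrite exprn_gt0.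
  rewrite -(ler_pM2r cM) (le_trans (H _ _))//.
  - by move=> h /hs1 ->.
  - move=> z zrho; have := lowerJ z; rewrite zrho rho0 rho1 => /(_ isT).
    by rewrite -[_ * n.+1%:R * _]mulrAC invfM mulrA.
  rewrite szhs -[leRHS]mulrA.
  apply: (@le_trans _ _ (K * be ^+ n * be ^+ n.*2)).
    apply: ler_pM; rewrite ?exprn_ge0// ?addr_ge0 ?exprn_ge0 ?(ltW rho0)//.
    by rewrite lerXn2r ?nnegrE ?addr_ge0 ?exprn_ge0 ?(ltW rho0)//; lra.
  have -> : K * D / c ^+ M.-1 * be ^+ n * be ^+ n * (be ^+ n.*2 * (c / n.+1%:R) ^+ M.-1) =
      K * be ^+ n * be ^+ n.*2 * (D * be ^+ n / n.+1%:R ^+ M.-1).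
    rewrite (expr_div_n c); have : c ^+ M.-1 != 0 by rewrite expf_neq0// lt0r_neq0.
    move: (c ^+ M.-1) (n.+1%:R ^+ M.-1 : R) (be ^+ n) (be ^+ n.*2) => x y u v x0.
    have -> : K * D / x * u * u * (v * (x / y)) = K * u * v * (D * u / y) * (x / x) by ring.
    by rewrite mulfV// mulr1.
  rewrite ler_peMr ?mulr_ge0 ?exprn_ge0 ?(ltW be0) ?(ltW K0)//.
  by rewrite ler_pdivlMr ?exprn_gt0// mul1r.
apply: (le_trans (ler_wpM2l _ H)); first by rewrite exprn_ge0// ltW.
set C := K * D / _.
have C0 : 0 <= C by rewrite divr_ge0 ?mulr_ge0 ?exprn_ge0 ?ltW.
clearbody C; rewrite [leLHS](_ : _ = C * (be ^+ n) ^+ 6); last by rewrite -addnn exprD; ring.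
apply: ler_wpM2l => //; rewrite -exprM mulnC exprM.
by rewrite lerXn2r ?nnegrE ?exprn_ge0 ?(ltW be0)//; lra.
Qed.

End sup_bound.

End regularity.

(** * Localization *)

Section local_density.
Context {R : realType} (mu : {finite_measure set (measurableTypeR R) -> \bar R}).
Local Notation leb := (@lebesgue_measure R).

(** The singular part [nu] lives on the null set [N]. Absolute continuity gives [mu (A]&[N) = 0],
    and as the integral of [w] over a null set vanishes, so does [nu (A]&[N)]. *)
Lemma ac_density_itv (w : R -> R) (a b u v : R) : -1 < a -> b < 1 -> u < a -> b < v ->
  ac_density mu w -> ac_on_oitv mu u v ->
  forall A : set (measurableTypeR R), measurable A -> A `<=` `[a, b] ->
    mu A = (\int[leb]_(x in A) (w x)%:E)%E.
Proof.
move=> a1 b1 ua bv [int_w [nu [N [mN N0 nuN muE]]]] ac A mA Aab.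
have A1 : A `<=` `]-1, 1[.
  move=> x /Aab; rewrite /= !in_itv/= => /andP[x1 x2].
  by rewrite (lt_le_trans a1)// (le_lt_trans x2).
rewrite muE//; suff -> : nu A = 0%E by rewrite adde0.
have mAN : measurable (A `&` N) by exact: measurableI.
have AN0 : leb (A `&` N) = 0%E.
  apply/eqP; rewrite -measure_le0 -N0; apply: le_measure; rewrite ?inE//.
have muAN : mu (A `&` N) = 0%E.
  have := (null_content_dominatesP _ _).1 ac _ mAN AN0.
  rewrite /mrestr setIidl// => x [/Aab]; rewrite /= !in_itv/= => /andP[x1 x2] _.
  by rewrite (lt_le_trans ua)// (le_lt_trans x2).
have nuAN : nu (A `&` N) = 0%E.
  move: muAN; rewrite muE//; last by move=> x [/A1].
  rewrite null_set_integral ?add0e//.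
  apply: (measurable_funS (measurable_itv `]-1, 1[)); first by move=> x [/A1].
  exact: measurable_int int_w.
have mD : measurable (A `\` N) by exact: measurableD.
have nuAD : nu (A `\` N) = 0%E.
  apply/eqP; rewrite -measure_le0 -nuN; apply: le_measure; rewrite ?inE//.
    by apply: measurableC; exact: mN.
have e : A = (A `&` N) `|` (A `\` N) by rewrite setUIDK.
apply/eqP; rewrite -measure_le0 e (le_trans (measureU2 _ mAN mD))//.
by rewrite [X in (X + _)%E]nuAN [X in (_ + X)%E]nuAD adde0.
Qed.

(** Heine-Cantor with [t] free to leave the interval: [q] is continuous at each of its points as a
    function on the whole line. *)
Lemma unif_continuous_itv (q : R -> R) (a b e : R) :
  (forall x, x \in `[a, b] -> {for x, continuous q}) -> 0 < e ->
  exists2 de, 0 < de & forall x t, x \in `[a, b] -> `|t - x| < de -> `|q t - q x| <= e.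
Proof.
move=> cq e0.
have cpt : compact (`[a, b] : set R) by exact: segment_compact.
have := (compact_near_coveringP _).1 cpt R (0 : R)^'+
  (fun de x => forall t, `|t - x| < de -> `|q t - q x| <= e) _.
case.
  move=> x xab; have := cq x xab.
  move=> /cvgrPdist_le /(_ (e / 2)) /(_ (divr_gt0 e0 (ltr0n _ 2))).
  move=> /nbhs_ballP[eta /= eta0 h].
  exists (ball x (eta / 2), [set de | 0 < de < eta / 2]) => /=.
    split; first by apply: nbhsx_ballx; rewrite divr_gt0.
    exists (eta / 2) => /=; first by rewrite divr_gt0.
    by move=> z /=; rewrite sub0r normrN => + z0; rewrite gtr0_norm// z0.
  move=> [y de] /= [xy /andP[de0 de1]] t ty.
  have yE : `|q x - q y| <= e / 2.
    by apply: h; rewrite /ball/= (lt_trans xy)//; lra.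
  have tE : `|q x - q t| <= e / 2.
    apply: h; rewrite /ball/= -(subrKA y) (le_lt_trans (ler_normD _ _))//.
    move: xy; rewrite /ball/= => xy; rewrite [`|y - t|]distrC; lra.
  rewrite -(subrKA (q x)) (le_trans (ler_normD _ _))// distrC.
  lra.
move=> r /= r0 h; exists (r / 2); first by rewrite divr_gt0.
move=> x t xab tx; apply: (h (r / 2)) => //=.
- by rewrite sub0r normrN gtr0_norm ?divr_gt0//; lra.
- by rewrite divr_gt0.
Qed.

End local_density.

Section local_estimates.
Context {R : realType}.
Implicit Types (P Q S : {poly R}) (x t : R).

Lemma cheb_int_ge0 P : (forall t, -1 <= t <= 1 -> 0 <= P.[t]) -> 0 <= cheb_int P.
Proof.
move=> P0; apply: mulr_ge0; first by rewrite invr_ge0 pi_ge0.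
by apply: Rintegral_ge0 => t _; rewrite P0// cos_geN1 cos_le1.
Qed.

Lemma deriv_pair_eval x P : deriv_pair 0 x 1 0 0 P = P.[x].
Proof. by rewrite /deriv_pair mul0r addr0 derivn0 expr0 divr1. Qed.

(** Extremal inequality for the evaluation at [x], encoded as [deriv_pair 0 x 1 0 0]. It turns norm
    bounds into pointwise bounds away from the peak. *)
Lemma sqr_horner_le (I : {scalar {poly R}}) (p : nat -> {poly R}) n M x Q :
  (forall n, size (p n) = n.+1) -> (forall m n, I (p m * p n) = (m == n)%:R) ->
  0 <= I (Q ^+ 2) -> (forall k, (k < n)%N -> (p k).[x] ^+ 2 <= M) -> (size Q <= n)%N ->
  Q.[x] ^+ 2 <= n%:R * M * I (Q ^+ 2).
Proof.
move=> sp orth IQ pM sQ.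
have := christoffel_upper I p sp orth (deriv_pair 0 x 1 0 0) n Q sQ.
rewrite /= deriv_pair_eval => /le_trans; apply; apply: ler_wpM2r => //.
rewrite /christoffel mulr_natl -[X in _ *+ X]card_ord -sumr_const.
by apply: ler_sum => k _; rewrite /= deriv_pair_eval pM.
Qed.

Lemma sqr_chebN_le k x : -1 <= x <= 1 -> (chebN k).[x] ^+ 2 <= 2.
Proof.
move=> x1; rewrite /chebN hornerZ exprMn.
have h : (chebT k).[x] ^+ 2 <= 1.
  by rewrite -real_normK ?num_real// exprn_ile1// norm_chebT_le1.
case: ifP => _; first by rewrite expr1n mul1r (le_trans h)// ler1n.
by rewrite sqr_sqrtr// -[leRHS]mulr1 ler_pM2l.
Qed.

Lemma sqr_mul_le P S t : 0 <= S.[t] <= 1 -> ((P * S) ^+ 2).[t] <= (P ^+ 2).[t].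
Proof.
move=> /andP[S0 S1]; rewrite !horner_exp hornerM exprMn ler_piMr ?sqr_ge0//.
exact: exprn_ile1.
Qed.

(* The peak has degree about [n / h]; with [be ^ (2 h) <= 1 / r] its decay beats the growth
   [be ^ (2 n)], and what is left is bounded by a power of [n / h]. *)
Lemma peak_decay (r : R) h : 0 < r < 1 -> (0 < h)%N -> exists be K : R,
  [/\ 1 < be, 0 < K & forall n, (0 < n)%N ->
    n%:R * (be ^+ n) ^+ 2 * (r ^+ (n %/ h)) ^+ 2 <= K / n%:R].
Proof.
move=> /andP[r0 r1] h0.
have rV : 1 < r^-1 by rewrite invf_gt1.
have [be [be1 _ beh]] := exists_small_root r^-1 h.*2 rV.
have [C C0 hC] := succn_expn_le r^-1 2 rV.
have hR : 0 < h%:R :> R by rewrite ltr0n.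
exists be, (C * h%:R ^+ 2 / r); split => //.
  by rewrite divr_gt0// mulr_gt0// exprn_gt0.
move=> n n0; set k := (n %/ h)%N.
have nR : 0 < n%:R :> R by rewrite ltr0n.
have nk : (n <= h * k.+1)%N by rewrite mulnC ltnW// ltn_ceil.
have b1 : (be ^+ n) ^+ 2 <= r^-1 ^+ k.+1.
  rewrite -exprM (@le_trans _ _ (be ^+ (h.*2 * k.+1)))//.
    by rewrite ler_eXn2l// -muln2 mulnAC leq_mul2r nk orbT.
  by rewrite exprM lerXn2r ?nnegrE ?exprn_ge0// ?invr_ge0; lra.
have b2 : (r ^+ k) ^+ 2 * r^-1 ^+ k.+1 = r ^+ k / r.
  rewrite expr2 exprS [r^-1 * _]mulrC -!mulrA; congr (_ * _).
  by rewrite mulrA -exprMn mulfV ?expr1n ?mul1r// lt0r_neq0.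
have b3 : n%:R ^+ 2 * r ^+ k <= C * h%:R ^+ 2.
  have := hC k; rewrite exprVn ler_pdivlMr ?exprn_gt0// => h3.
  apply: (@le_trans _ _ (k.+1%:R ^+ 2 * r ^+ k * h%:R ^+ 2)); last first.
    by rewrite ler_pM2r// exprn_gt0.
  rewrite [leRHS]mulrAC ler_pM2r ?exprn_gt0// -exprMn lerXn2r ?nnegrE ?mulr_ge0//.
  by rewrite -natrM ler_nat mulnC.
apply: (@le_trans _ _ (n%:R * (r ^+ k / r))).
  rewrite -b2 -mulrA ler_pM2l// mulrC; apply: ler_wpM2l => //.
  by rewrite exprn_ge0// exprn_ge0// ltW.
rewrite ler_pdivlMr// [leLHS](_ : _ = n%:R ^+ 2 * r ^+ k / r); last by ring.
by rewrite ler_pM2r ?invr_gt0.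
Qed.
End local_estimates.

Lemma ltn_double_succ r s : (r < (r + s + 1).*2)%N /\ (s < (r + s + 1).*2)%N.
Proof. by split; lia. Qed.

Lemma itv_shrink {R : realType} (a b c d : R) : a < c -> d < b ->
  exists2 dl0 : R, 0 < dl0 & forall dl x t, dl <= dl0 ->
    x \in `[c, d] -> x - dl <= t <= x + dl -> t \in `[a, b].
Proof.
move=> ac db; exists (Num.min (c - a) (b - d)); first by rewrite lt_min !subr_gt0 ac.
move=> dl x t; rewrite le_min !in_itv/= => /andP[h1 h2] /andP[h3 h4] /andP[h5 h6].
by apply/andP; split; lra.
Qed.

(** * Comparison of the extremal values of the two measures *)

Section comparison.
Context {R : realType} (mu : {finite_measure set (measurableTypeR R) -> \bar R}).
Local Notation leb := (@lebesgue_measure R).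
Variables (p : nat -> {poly R}) (w : R -> R) (a b : R).
Hypothesis p_orth : orthonormal_polys mu p.
Hypothesis mu_regular : regular_polys p.
Hypotheses (a1 : -1 < a) (ab : a < b) (b1 : b < 1).
Hypothesis int_w : leb.-integrable `[a, b] (EFin \o w).
Hypothesis mu_w : forall A : set (measurableTypeR R), measurable A ->
  A `<=` `[a, b] -> mu A = (\int[leb]_(x in A) (w x)%:E)%E.
Hypothesis w_pos : forall x, x \in `[a, b] -> 0 < w x.
Hypothesis w_cont : forall x, x \in `[a, b] -> {for x, continuous w}.

Definition cheb_density (x : R) : R := w x * (pi * Num.sqrt (1 - x ^+ 2)).

Lemma mu_orthonormal m n : mu_int mu (p m * p n) = (m == n)%:R.
Proof.
have [_ _ orth] := p_orth; have := orth m n; rewrite /mu_int /Rintegral => h.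
by under eq_integral do rewrite hornerM; rewrite h.
Qed.

Lemma sqrt_itv_lower : exists2 s0 : R, 0 < s0 &
  forall x, x \in `[a, b] -> s0 <= Num.sqrt (1 - x ^+ 2).
Proof.
have a2 : 0 < 1 - a ^+ 2.
  by have : 0 < (1 - a) * (1 + a); [apply: mulr_gt0|]; move: a1 ab b1; lra.
have b2 : 0 < 1 - b ^+ 2.
  by have : 0 < (1 - b) * (1 + b); [apply: mulr_gt0|]; move: a1 ab b1; lra.
exists (Num.sqrt (Num.min (1 - a ^+ 2) (1 - b ^+ 2))).
  by rewrite sqrtr_gt0 lt_min a2.
move=> x; rewrite in_itv/= => /andP[ax xb]; apply: ler_wsqrtr.
rewrite ge_min; have [x0|x0] := leP 0 x; apply/orP.
  by right; have : 0 <= (b - x) * (b + x); [apply: mulr_ge0|]; lra.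
by left; have : 0 <= (x - a) * (- x - a); [apply: mulr_ge0|]; lra.
Qed.

Lemma cheb_density_cont x : x \in `[a, b] -> {for x, continuous cheb_density}.
Proof.
move=> xab; apply: continuousM; first exact: w_cont.
apply: continuousM; first exact: cst_continuous.
have -> : (fun x : R => Num.sqrt (1 - x ^+ 2)) =
    (fun x : R => Num.sqrt (1 - 'X ^+ 2).[x]).
  by apply/funext => y; rewrite !hornerE.
apply: (@continuous_comp _ _ _ (fun y : R => (1 - 'X ^+ 2).[y]) (@Num.sqrt R) x).
  exact: continuous_horner.
exact: sqrt_continuous.
Qed.

Lemma cheb_density_lower : exists2 q0 : R, 0 < q0 &
  forall x, x \in `[a, b] -> q0 <= cheb_density x.
Proof.
have cq : {within `[a, b], continuous cheb_density}.
  by apply: continuous_in_subspaceT => x; rewrite inE; exact: cheb_density_cont.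
have [x0 x0ab hx0] := EVT_min (ltW ab) cq.
exists (cheb_density x0) => //; have [s0 s0_gt0 hs] := sqrt_itv_lower.
rewrite mulr_gt0 ?w_pos// mulr_gt0 ?pi_gt0//.
exact: lt_le_trans (hs _ x0ab).
Qed.

Section at_point.
Variables (x dl eta q : R) (L k n N r s : nat) (sg : R).
Hypotheses (dl0 : 0 < dl) (dl1 : dl <= 1) (x1 : -1 <= x <= 1).
Hypothesis J_ab : forall t, x - dl <= t <= x + dl -> t \in `[a, b].
Hypothesis qJ : forall t, x - dl <= t <= x + dl -> q - eta <= cheb_density t <= q + eta.
Hypotheses (rL : (r < L.*2)%N) (sL : (s < L.*2)%N) (eta0 : 0 < eta) (etaq : eta < q).

Let rr := 1 - (dl / 2) ^+ L.*2.
Let S := peak x L.*2 k.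
Let m := (L.*2 * k)%N.
Let l := deriv_pair sg x N r s.

Let rr0 : 0 <= rr.
Proof.
by rewrite subr_ge0 exprn_ile1 ?divr_ge0 ?(ltW dl0)// ler_pdivrMr// mul1r (le_trans dl1)// ler1n.
Qed.

Let S01 t : -1 <= t <= 1 -> 0 <= S.[t] <= 1.
Proof. by move=> t1; apply: peak_ge0_le1; rewrite ler_norml. Qed.

Let S_small t : -1 <= t <= 1 -> ~~ (x - dl <= t <= x + dl) -> S.[t] ^+ 2 <= (rr ^+ k) ^+ 2.
Proof.
move=> t1 tJ; have /andP[S0 _] := S01 t t1.
rewrite lerXn2r ?nnegrE ?exprn_ge0//.
apply: peak_le; rewrite ?ler_norml//.
by rewrite leNgt; apply: contra tJ => /ltW; rewrite ler_distl.
Qed.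

Let lS Q : l (Q * S) = l Q.
Proof. exact: deriv_pair_peak. Qed.

Let x_dl : -1 < x - dl.
Proof.
have : x - dl <= x - dl <= x + dl by rewrite lexx lerD2l (le_trans _ (ltW dl0))// oppr_le0 ltW.
by move=> /J_ab; rewrite in_itv/= => /andP[h _]; rewrite (lt_le_trans a1).
Qed.

Let x_dl' : x + dl < 1.
Proof.
have : x - dl <= x + dl <= x + dl by rewrite lexx lerD2l (le_trans _ (ltW dl0))// oppr_le0 ltW.
by move=> /J_ab; rewrite in_itv/= => /andP[_ h]; rewrite (le_lt_trans h).
Qed.

Let dl_le : x - dl <= x + dl.
Proof. by rewrite lerD2l (le_trans _ (ltW dl0))// oppr_le0 ltW. Qed.

Let J_sub : `[x - dl, x + dl]%classic `<=` (`[a, b]%classic : set R).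
Proof. by move=> t /=; rewrite in_itv/= => /J_ab. Qed.

Let int_wJ : leb.-integrable `[x - dl, x + dl] (EFin \o w).
Proof. by apply: integrableS int_w => //; exact: J_sub. Qed.

Let mu_wJ (A : set (measurableTypeR R)) : measurable A ->
  A `<=` `[x - dl, x + dl] -> mu A = (\int[leb]_(x in A) (w x)%:E)%E.
Proof. by move=> mA AJ; apply: mu_w => //; exact: subset_trans AJ J_sub. Qed.

Let tail_bound Q (M C : R) t : 0 <= M -> -1 <= t <= 1 -> ~~ (x - dl <= t <= x + dl) ->
  Q.[t] ^+ 2 <= M * C -> ((Q * S) ^+ 2).[t] <= M * (rr ^+ k) ^+ 2 * C.
Proof.
move=> M0 t1 tJ QM; rewrite horner_exp hornerM exprMn [leRHS]mulrAC.
by apply: ler_pM; rewrite ?sqr_ge0// S_small.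
Qed.

(** Near [x] the weight is at least [q - eta] times the arcsine density, whence the inverse.
    Elsewhere the product with the peak is controlled only through [M], a bound that may grow with
    [n] and must be beaten by [(rr ^+ k) ^+ 2]. *)
Lemma christoffel_upper_local (M : R) : 0 <= M ->
  (forall j t, (j < n)%N -> -1 <= t <= 1 -> (p j).[t] ^+ 2 <= M) ->
  n%:R * M * (rr ^+ k) ^+ 2 <= eta ->
  christoffel p l n <= ((q - eta)^-1 + eta) * christoffel chebN l (n + m).
Proof.
move=> M0 pM small; have [size_p _ _] := p_orth.
have lo0 : 0 < q - eta by rewrite subr_gt0.
apply: (christoffel_transfer (mu_int mu) cheb_int p chebN size_p size_chebN
  mu_orthonormal chebN_orthonormal _ S) => //.
- by apply: addr_ge0; rewrite ?invr_ge0 ltW.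
- exact: size_peak.
move=> Q sQ; have IQ : 0 <= mu_int mu (Q ^+ 2).
  by apply: mu_int_ge0 => t _; rewrite horner_exp sqr_ge0.
have h := cheb_int_le mu w (x - dl) (x + dl) (q - eta) (q + eta)
  (n%:R * M * (rr ^+ k) ^+ 2 * mu_int mu (Q ^+ 2)) ((Q * S) ^+ 2)
  x_dl dl_le x_dl' (ltW lo0) int_wJ mu_wJ qJ.
have {}h : (q - eta) * cheb_int ((Q * S) ^+ 2) <= mu_int mu ((Q * S) ^+ 2) +
    (q - eta) * (n%:R * M * (rr ^+ k) ^+ 2 * mu_int mu (Q ^+ 2)).
  apply: h => [t|t t1 tJ|].
  - by rewrite horner_exp sqr_ge0.
  - apply: tail_bound => //; first by rewrite mulr_ge0.
    apply: (sqr_horner_le (mu_int mu) p) => //; first exact: mu_orthonormal.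
    by move=> j jn; exact: pM.
  - by rewrite !mulr_ge0 ?exprn_ge0.
have IQS : mu_int mu ((Q * S) ^+ 2) <= mu_int mu (Q ^+ 2).
  rewrite -subr_ge0 -linearB; apply: mu_int_ge0 => t /andP[t0 t1].
  by rewrite hornerD hornerN subr_ge0 sqr_mul_le// S01// !ltW.
rewrite mulrDl -(ler_pM2l lo0) (le_trans h)// mulrDr.
apply: lerD; first by rewrite mulrA mulfV ?mul1r// lt0r_neq0.
by rewrite ler_pM2l// ler_wpM2r.
Qed.

(** The reverse comparison starts from the arcsine measure, for which the basis is bounded and 2
    replaces [M]. Starting in degree less than [n - m] leaves room for the peak. *)
Lemma christoffel_lower_local : (m <= n)%N ->
  n%:R * 2 * (rr ^+ k) ^+ 2 * mu_int mu 1 <= eta ->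
  christoffel chebN l (n - m) <= (q + eta + eta) * christoffel p l n.
Proof.
move=> mn small; have [size_p _ _] := p_orth.
have q0 : 0 < q by exact: lt_trans etaq.
have lo0 : 0 <= q - eta by rewrite subr_ge0 ltW.
have I1 : 0 <= mu_int mu 1 by apply: mu_int_ge0 => t _; rewrite hornerC.
rewrite -[n in christoffel p l n](subnK mn).
apply: (christoffel_transfer cheb_int (mu_int mu) chebN p size_chebN size_p
  chebN_orthonormal mu_orthonormal _ S) => //.
- by rewrite addr_ge0 ?addr_ge0 ?(ltW q0) ?(ltW eta0).
- exact: size_peak.
move=> Q sQ; have EQ : 0 <= cheb_int (Q ^+ 2).
  by apply: cheb_int_ge0 => t _; rewrite horner_exp sqr_ge0.
have h : mu_int mu ((Q * S) ^+ 2) <= (q + eta) * cheb_int ((Q * S) ^+ 2) +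
    n%:R * 2 * (rr ^+ k) ^+ 2 * cheb_int (Q ^+ 2) * mu_int mu 1.
  apply: (mu_int_le mu w (x - dl) (x + dl) (q - eta)) => // [t|t t1 tJ|].
  - by rewrite horner_exp sqr_ge0.
  - apply: tail_bound => //.
    apply: (@le_trans _ _ ((n - m)%:R * 2 * cheb_int (Q ^+ 2))); last first.
      by rewrite ler_wpM2r// ler_wpM2r// ler_nat leq_subr.
    apply: (sqr_horner_le cheb_int chebN) => //; [exact: size_chebN|exact: chebN_orthonormal|].
    by move=> j _; exact: sqr_chebN_le.
  - by apply: mulr_ge0 => //; apply: mulr_ge0; rewrite ?sqr_ge0 ?mulr_ge0.
have EQS : cheb_int ((Q * S) ^+ 2) <= cheb_int (Q ^+ 2).
  rewrite -subr_ge0 -linearB; apply: cheb_int_ge0 => t t1.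
  by rewrite hornerD hornerN subr_ge0 sqr_mul_le// S01.
rewrite (le_trans h)// [leRHS]mulrDl; apply: lerD.
  by apply: ler_wpM2l => //; rewrite addr_ge0// ltW.
by rewrite [leLHS]mulrAC ler_wpM2r.
Qed.

End at_point.

Variables (c d : R).
Hypotheses (ac : a < c) (db : d < b).

(** The order of choices gives uniformity: [eta] depends on [e], the width [dl] on [eta], the ratio
    [h] on [eta], the admissible growth [be] on [dl] and [h], the constant [CP] on [be], and [n]
    comes last; none depends on [x]. *)
Lemma christoffel_comparison (r s : nat) (sg e : R) : `|sg| <= 1 -> 0 < e ->
  exists n0 : nat, forall n x, (n0 <= n)%N -> x \in `[c, d] ->
    `|christoffel p (deriv_pair sg x n r s) n / n%:R -
      christoffel chebN (deriv_pair sg x n r s) n / n%:R / cheb_density x| <= e.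
Proof.
move=> sg1 e0; have [size_p lead_p _] := p_orth.
have [s0 s0_gt0 hs0] := sqrt_itv_lower.
have [B B0 hB] := christoffel_cheb_le r s s0 s0_gt0.
have [q0 q0_gt0 hq0] := cheb_density_lower.
have [eta /andP[eta0 etaq] hlim] := transfer_limit B q0 e B0 q0_gt0 e0.
have [de de0 hde] := unif_continuous_itv cheb_density a b eta cheb_density_cont eta0.
have [dl0 dl0_gt0 hdl] := itv_shrink a b c d ac db.
pose dl := Num.min (Num.min (de / 2) 1) dl0.
have dl_gt0 : 0 < dl by rewrite !lt_min divr_gt0// ltr01.
have [dl1 dl2 dl3] : [/\ dl <= de / 2, dl <= 1 & dl <= dl0].
  by rewrite !ge_min !lexx ?orbT.
clearbody dl; have [rL sL] := ltn_double_succ r s.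
set L := (r + s + 1)%N in rL sL.
have L0 : (0 < L.*2)%N by exact: leq_trans rL.
pose rr := 1 - (dl / 2) ^+ L.*2.
have rr01 : 0 < rr < 1.
  have h1 : dl / 2 < 1 by rewrite ltr_pdivrMr// mul1r (le_lt_trans dl2)// ltr1n.
  rewrite /rr subr_gt0 ltrBlDr ltrDl exprn_gt0 ?divr_gt0// andbT.
  by rewrite exprn_ilt1 ?divr_ge0 ?(ltW dl_gt0)// -lt0n.
(* The first summand ensures [m <= n] for the peak degree [m = 2 L * (n %/ h)]; the second ensures
   [B * m <= eta * n], so that changing the degree by [m] costs at most [eta] after division by
   [n]. *)
pose h := (L.*2 + Num.bound (B * L.*2%:R / eta))%N.
have hL : (L.*2 <= h)%N by rewrite leq_addr.
have h0 : (0 < h)%N by exact: leq_trans hL.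
have hB_eta : B * L.*2%:R <= eta * h%:R.
  rewrite mulrC [eta * _]mulrC -ler_pdivrMr// [_ * B]mulrC.
  have x0 : 0 <= B * L.*2%:R / eta by rewrite divr_ge0 ?mulr_ge0// ltW.
  by rewrite (le_trans (ltW (archi_boundP x0)))// ler_nat leq_addl.
clearbody h.
have [be [K [be1 K0 hK]]] := peak_decay rr h rr01 h0.
have I_ge0 : forall P : {poly R}, (forall t, -1 < t < 1 -> 0 <= P.[t]) -> 0 <= mu_int mu P.
  by move=> P; exact: mu_int_ge0.
have [CP CP0 hCP] := regular_sup_bound (mu_int mu) p I_ge0 size_p lead_p mu_orthonormal
  mu_regular be be1.
pose mu1 := mu_int mu 1.
have mu1_ge0 : 0 <= mu1 by apply: I_ge0 => t _; rewrite hornerC.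
(* The two tails, [CP ^ 2] for the polynomials of [mu] and [2 * mu1] for the Chebyshev ones, both
   decay like [K / n], so a single condition [T / n <= eta] covers them. *)
pose T := (CP ^+ 2 + 2 * mu1) * K.
have T0 : 0 <= T.
  by apply: mulr_ge0; [apply: addr_ge0; [exact: sqr_ge0|exact: mulr_ge0]|exact: ltW].
exists (Num.bound (T / eta)).+1 => n x n_large xcd.
have n0 : (0 < n)%N by exact: leq_trans n_large.
have nR : 0 < n%:R :> R by rewrite ltr0n.
have Tn : T / n%:R <= eta.
  rewrite ler_pdivrMr// mulrC -ler_pdivrMr//.
  have x0 : 0 <= T / eta by rewrite divr_ge0// ltW.
  by rewrite (le_trans (ltW (archi_boundP x0)))// ler_nat ltnW.
set k := (n %/ h)%N in n_large *; set m := (L.*2 * k)%N.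
have mh : (m * h <= L.*2 * n)%N by rewrite -mulnA leq_mul2l leq_divM orbT.
have mn : (m <= n)%N.
  by rewrite (leq_trans (leq_mul hL (leqnn k)))// mulnC leq_divM.
have Bm : B * m%:R <= eta * n%:R.
  have hR : 0 < h%:R :> R by rewrite ltr0n.
  rewrite -(ler_pM2r hR) -mulrA -natrM (le_trans (ler_wpM2l (ltW B0) (_ : _ <= (L.*2 * n)%:R)))//.
    by rewrite ler_nat.
  by rewrite natrM mulrA [leRHS]mulrAC ler_pM2r.
have J_ab t : x - dl <= t <= x + dl -> t \in `[a, b] by exact: hdl.
have xab : x \in `[a, b].
  by apply: J_ab; rewrite gerDl oppr_le0 lerDl ltW.
have x1 : -1 <= x <= 1.
  move: xab; rewrite in_itv/= => /andP[xa xb].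
  by rewrite (le_trans (ltW a1))// (le_trans xb (ltW b1)).
have sx := hs0 x xab.
set q := cheb_density x; have qx : q0 <= q by exact: hq0.
have etaq' : eta < q by exact: lt_le_trans qx.
have qJ t : x - dl <= t <= x + dl -> q - eta <= cheb_density t <= q + eta.
  move=> tJ; have : `|t - x| < de.
    have /le_lt_trans : `|t - x| <= dl by rewrite ler_distl.
    by apply; rewrite (le_lt_trans dl1)// ltr_pdivrMr// ltr_pMr// ltr1n.
  by move=> /(hde x t xab); rewrite ler_distl.
pose D := n%:R * (be ^+ n) ^+ 2 * (rr ^+ k) ^+ 2.
have hD : D <= K / n%:R by exact: hK.
have be_n : 1 <= (be ^+ n) ^+ 2 by rewrite exprn_ege1// exprn_ege1// ltW.
have TnE : CP ^+ 2 * (K / n%:R) + 2 * mu1 * (K / n%:R) <= eta.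
  by rewrite -mulrDl mulrA.
have KN0 : 0 <= K / n%:R by rewrite divr_ge0// ltW.
set l := deriv_pair sg x n r s.
have up : christoffel p l n <= ((q - eta)^-1 + eta) * christoffel chebN l (n + m).
  apply: (christoffel_upper_local x dl eta q L k n n r s sg dl_gt0 dl2 x1 J_ab qJ rL sL
    eta0 etaq' ((CP * be ^+ n) ^+ 2)); first exact: sqr_ge0.
    move=> j t jn t1.
    rewrite -real_normK ?num_real// lerXn2r ?nnegrE ?normr_ge0//.
      by rewrite mulr_ge0 ?exprn_ge0 ?(ltW CP0)// (le_trans _ (ltW be1)).
    rewrite (le_trans (hCP j t t1))// ler_pM2l// ler_eXn2l// ltnW//.
  rewrite exprMn (_ : _ * _ = CP ^+ 2 * D); last by rewrite /D; ring.
  apply: (le_trans _ TnE); rewrite -[leLHS]addr0; apply: lerD.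
    by apply: ler_wpM2l => //; exact: sqr_ge0.
  by apply: mulr_ge0; rewrite // mulr_ge0.
have lowr : christoffel chebN l (n - m) <= (q + eta + eta) * christoffel p l n.
  apply: (christoffel_lower_local x dl eta q L k n n r s sg) => //.
  apply: (le_trans _ TnE); rewrite -[leLHS]add0r; apply: lerD.
    by rewrite mulr_ge0 ?sqr_ge0.
  apply: (@le_trans _ _ (2 * mu1 * D)); last by apply: ler_wpM2l => //; exact: mulr_ge0.
  rewrite [leLHS](_ : _ = 2 * mu1 * (n%:R * 1 * (rr ^+ k) ^+ 2)); last by rewrite -/mu1; ring.
  apply: ler_wpM2l; first exact: mulr_ge0.
  by rewrite ler_wpM2r ?sqr_ge0// ler_wpM2l.
have nm2 : (n + m <= n.*2)%N by rewrite -addnn leq_add2l.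
have c1 : christoffel chebN l (n + m) <= christoffel chebN l n + B * m%:R.
  by have := hB n (n + m)%N n sg x n0 (leq_addr _ _) nm2 sg1 x1 sx; rewrite addKn.
have c2 : christoffel chebN l n <= christoffel chebN l (n - m) + B * m%:R.
  have := hB (n - m)%N n n sg x n0 (leq_subr _ _) _ sg1 x1 sx.
  by rewrite subKn// -addnn leq_addr => /(_ isT).
have c3 : christoffel chebN l n <= B * n%:R.
  have := hB 0%N n n sg x n0 (leq0n _) _ sg1 x1 sx.
  by rewrite subn0 /christoffel big_ord0 add0r -addnn leq_addr => /(_ isT).
apply: hlim => //.
- by rewrite divr_ge0 ?christoffel_ge0.
- by rewrite divr_ge0 ?christoffel_ge0//= ler_pdivrMr.
- rewrite ler_pdivrMr// -[leRHS]mulrA [(_ / _ + _) * _]mulrDl mulfVK ?lt0r_neq0//.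
  apply: (le_trans up); apply: ler_wpM2l.
    by apply: addr_ge0; rewrite ?invr_ge0 ?subr_ge0 ltW.
  by rewrite (le_trans c1)// lerD2l.
rewrite mulrA ler_pdivlMr// mulrBl mulfVK ?lt0r_neq0//.
by rewrite (le_trans _ lowr)// lerBlDr (le_trans c2)// lerD2l.
Qed.

End comparison.

(** * Convergence of the kernels *)

Lemma cheb_kernel_uniform {R : realType} (r s : nat) (s0 e : R) : 0 < s0 -> 0 < e ->
  exists n0 : nat, forall n x, (n0 <= n)%N -> -1 <= x <= 1 ->
    s0 <= Num.sqrt (1 - x ^+ 2) ->
    `|cd_kernel_diag chebN r s n x / n%:R ^+ (r + s + 1) -
      tau R r s / Num.sqrt (1 - x ^+ 2) ^+ (r + s)| <= e.
Proof.
move=> s0_gt0 e0; have [C C0 hC] := cheb_kernel_asymptotics r s s0 s0_gt0.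
pose T := C / s0 ^+ (r + s).
have T0 : 0 <= T by rewrite divr_ge0 ?exprn_ge0// ltW.
exists (Num.bound (T / e)).+1 => n x n_large x1 sx.
have n0 : (0 < n)%N by exact: leq_trans n_large.
have nR : 0 < n%:R :> R by rewrite ltr0n.
set y := Num.sqrt (1 - x ^+ 2) in sx *.
have y0 : 0 < y by exact: lt_le_trans sx.
have h := hC n x n0 x1 sx; rewrite -/y in h.
have np : 0 < n%:R ^+ (r + s + 1) :> R by rewrite exprn_gt0.
have yp : 0 < y ^+ (r + s) by rewrite exprn_gt0.
have -> : cd_kernel_diag chebN r s n x / n%:R ^+ (r + s + 1) - tau R r s / y ^+ (r + s) =
    (y ^+ (r + s) * cd_kernel_diag chebN r s n x - n%:R ^+ (r + s + 1) * tau R r s) /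
    (y ^+ (r + s) * n%:R ^+ (r + s + 1)).
  move: (y ^+ _) (n%:R ^+ _ : R) yp np => u v u0 v0; field.
  by rewrite !lt0r_neq0.
rewrite normrM normfV (gtr0_norm (mulr_gt0 yp np)) ler_pdivrMr ?mulr_gt0//.
rewrite (le_trans h)//.
have Tn : T <= e * n%:R.
  rewrite mulrC -ler_pdivrMr//.
  have x0 : 0 <= T / e by rewrite divr_ge0// ltW.
  by rewrite (le_trans (ltW (archi_boundP x0)))// ler_nat ltnW.
apply: (@le_trans _ _ (T * s0 ^+ (r + s) * n%:R ^+ (r + s))).
  by rewrite /T mulfVK// expf_neq0// lt0r_neq0.
rewrite addn1 exprSr (_ : e * _ = e * n%:R * (y ^+ (r + s)) * n%:R ^+ (r + s)); last by ring.
rewrite ler_pM2r ?exprn_gt0//; apply: ler_pM; rewrite ?exprn_ge0 ?(ltW s0_gt0)//.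
by rewrite lerXn2r ?nnegrE ?(ltW y0) ?(ltW s0_gt0).
Qed.

Theorem corollary1p3 (R : realType)
    (mu : {finite_measure set (measurableTypeR R) -> \bar R})
    (mu_carrier : mu (~` `]-1, 1[) = 0%E)
    (mu_infinite : infinite_set (msupport mu))
    (p : nat -> {poly R}) (p_orth : orthonormal_polys mu p)
    (mu_regular : regular_polys p)
    (w : R -> R) (w_density : ac_density mu w)
    (a b : R) (lt_m1a : -1 < a) (lt_ab : a < b) (lt_b1 : b < 1)
    (mu_ac : exists u v : R, [/\ u < a, b < v & ac_on_oitv mu u v])
    (w_pos : forall x, x \in `[a, b] -> 0 < w x)
    (w_cont : forall x, x \in `[a, b] -> {for x, continuous w})
    (r s : nat)
    (c d : R) (lt_ac : a < c) (le_cd : c <= d) (lt_db : d < b) :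
  {uniform `[c, d],
     (fun (n : nat) (x : R) =>
        (n%:R ^+ (r + s + 1))^-1 * cd_kernel_diag p r s n x) @ \oo -->
     (fun x : R =>
        (pi * w x * (1 - x ^+ 2) `^ ((r + s + 1)%:R / 2))^-1 * tau R r s)}.
Proof.
have [u [v [ua bv ac]]] := mu_ac.
have int_w : lebesgue_measure.-integrable `[a, b] (EFin \o w).
  have [iw _] := w_density; apply: integrableS iw; rewrite ?measurable_itv//.
  move=> x /=; rewrite !in_itv/= => /andP[xa xb].
  by rewrite (lt_le_trans lt_m1a)// (le_lt_trans xb).
have mu_w := ac_density_itv mu w a b u v lt_m1a lt_b1 ua bv w_density ac.
have [s0 s0_gt0 hs0] := sqrt_itv_lower a b lt_m1a lt_ab lt_b1.
have [q0 q0_gt0 hq0] := cheb_density_lower w a b lt_m1a lt_ab lt_b1 w_pos w_cont.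
pose q := cheb_density w.
have limit_bound (e : R) : 0 < e -> exists n0 : nat, forall n x, (n0 <= n)%N ->
    x \in `[c, d] -> `|cd_kernel_diag p r s n x / n%:R ^+ (r + s + 1) -
      tau R r s / Num.sqrt (1 - x ^+ 2) ^+ (r + s) / q x| <= e.
  move=> e0; have e2 : 0 < e / 2 by rewrite divr_gt0.
  (* The Chebyshev limit is later divided by [q x >= q0], which brings this tolerance back to
     [e / 2]. *)
  have eq : 0 < e / 2 * q0 by rewrite mulr_gt0.
  have comp sg (sg1 : `|sg| <= 1) := christoffel_comparison mu p w a b p_orth mu_regular
    lt_m1a lt_ab lt_b1 int_w mu_w w_pos w_cont c d lt_ac lt_db r s sg e sg1 e0.
  have [n1 h1] : exists n1 : nat, forall n x, (n1 <= n)%N -> x \in `[c, d] ->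
      `|christoffel p (deriv_pair 1 x n r s) n / n%:R -
        christoffel chebN (deriv_pair 1 x n r s) n / n%:R / q x| <= e.
    by apply: comp; rewrite normr1.
  have [n2 h2] : exists n2 : nat, forall n x, (n2 <= n)%N -> x \in `[c, d] ->
      `|christoffel p (deriv_pair (-1) x n r s) n / n%:R -
        christoffel chebN (deriv_pair (-1) x n r s) n / n%:R / q x| <= e.
    by apply: comp; rewrite normrN1.
  have [n3 h3] := cheb_kernel_uniform r s s0 (e / 2 * q0) s0_gt0 eq.
  exists (n1 + n2 + n3).+1 => n x n_large xcd.
  have xab : x \in `[a, b].
    move: xcd; rewrite !in_itv/= => /andP[xc xd].
    by rewrite (le_trans (ltW lt_ac))// (le_trans xd (ltW lt_db)).
  have x1 : -1 <= x <= 1.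
    move: xab; rewrite in_itv/= => /andP[xa xb].
    by rewrite (le_trans (ltW lt_m1a))// (le_trans xb (ltW lt_b1)).
  have {}h1 := h1 n x _ xcd; have {}h2 := h2 n x _ xcd.
  have {}h3 := h3 n x _ x1 (hs0 x xab).
  have ln1 : (n1 <= n)%N by rewrite (leq_trans _ n_large)// -addnA leqW// leq_addr.
  have ln2 : (n2 <= n)%N.
    by rewrite (leq_trans _ n_large)// addnAC leqW// leq_addl.
  have ln3 : (n3 <= n)%N by rewrite (leq_trans _ n_large)// leqW// leq_addl.
  have nR : 0 < n%:R :> R by rewrite ltr0n (leq_trans _ n_large).
  have n_pow : n%:R ^+ (r + s + 1) = n%:R ^+ (r + s) * n%:R :> R by rewrite addn1 exprSr.
  (* Polarization divides by 4, so two errors of size [e] contribute at most [e / 2]. *)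
  have K_pol (p' : nat -> {poly R}) : cd_kernel_diag p' r s n x / n%:R ^+ (r + s + 1) =
      (christoffel p' (deriv_pair 1 x n r s) n / n%:R -
       christoffel p' (deriv_pair (-1) x n r s) n / n%:R) / 4.
    rewrite -mulrBl polarization n_pow; field.
    by rewrite expf_neq0 lt0r_neq0.
  have {}h1 := h1 ln1; have {}h2 := h2 ln2; have {}h3 := h3 ln3.
  rewrite (K_pol chebN) in h3; rewrite K_pol.
  have qx := hq0 x xab; rewrite -/(q x) in qx.
  have q_gt0 : 0 < q x by exact: lt_le_trans qx.
  move: h1 h2 h3.
  set X1 := christoffel p _ n / _; set X2 := christoffel p _ n / _.
  set Y1 := christoffel chebN _ n / _; set Y2 := christoffel chebN _ n / _.
  set t := tau R r s / _ => h1 h2 h3.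
  rewrite (_ : _ - _ = (X1 - Y1 / q x - (X2 - Y2 / q x)) / 4 +
    ((Y1 - Y2) / 4 - t) / q x); last by ring.
  have h4 : `|((Y1 - Y2) / 4 - t) / q x| <= e / 2.
    rewrite normrM normfV (gtr0_norm q_gt0) ler_pdivrMr// (le_trans h3)//.
    by rewrite ler_pM2l.
  have h5 : `|(X1 - Y1 / q x - (X2 - Y2 / q x)) / 4| <= e / 2.
    rewrite normrM normfV (gtr0_norm (ltr0n R 4)) ler_pdivrMr//.
    by rewrite (le_trans (ler_normB _ _))// (le_trans (lerD h1 h2))//; lra.
  by rewrite (le_trans (ler_normD _ _))// (le_trans (lerD h5 h4))//; lra.
move=> P /uniform_nbhs[E [entE EP]].
move: entE; rewrite -entourage_ballE => -[e /= e0 eE].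
have e2 : 0 < e / 2 by rewrite divr_gt0.
have [n0 hn0] := limit_bound (e / 2) e2.
exists n0 => // n /= n0n; apply: EP => x /= xcd; apply: eE => /=.
have xab : x \in `[a, b].
  move: xcd; rewrite !in_itv/= => /andP[xc xd].
  by rewrite (le_trans (ltW lt_ac))// (le_trans xd (ltW lt_db)).
have y0 : 0 < 1 - x ^+ 2 by rewrite -sqrtr_gt0 (lt_le_trans s0_gt0)// hs0.
rewrite /ball/= distrC; apply: (@le_lt_trans _ _ (e / 2)); last by lra.
rewrite (le_trans _ (hn0 n x n0n xcd))// mulrC.
(* The exponent [(r + s + 1) / 2] of [1 - x ^ 2] combines [r + s] square roots from the Chebyshev
   limit with the one contained in [q x]. *)
rewrite (_ : _^-1 * tau R r s = tau R r s / Num.sqrt (1 - x ^+ 2) ^+ (r + s) / q x)//.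
have -> : (1 - x ^+ 2) `^ ((r + s + 1)%:R / 2) = Num.sqrt (1 - x ^+ 2) ^+ (r + s + 1).
  by rewrite -powR12_sqrt ?(ltW y0)// -[RHS]powR_mulrn ?powR_ge0// -powRrM [_ / 2]mulrC.
rewrite /q /cheb_density addn1 exprSr !invfM; ring.
Qed.
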